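(* Let $Q=(q_{ij})$ be an irreducible single birth $Q$-matrix on $\mathbb Z_+$, fix $i_0\ge 0$ and an integer $\ell\ge 1$, and assume that the corresponding process is $(\ell-1)$-ergodic, i.e. $\mathbb E_i\sigma_{i_0}^{\ell-1}<\infty$ for every $i\ge 0$. When $\ell=1$, assume additionally that the process is unique (non-explosive). Then $$\mathbb E_n\sigma_{i_0}^\ell=\begin{cases}\displaystyle \ell\sum_{n\le k\le i_0-1}v_k^{(\ell)}+\Big[1-\sum_{n\le k\le i_0-1}u_k\Big]\mathbb E_{i_0}\sigma_{i_0}^\ell, & 0\le n\le i_0,\\[3mm] \displaystyle -\ell\sum_{i_0\le k\le n-1}v_k^{(\ell)}+\Big[1+\sum_{i_0\le k\le n-1}u_k\Big]\mathbb E_{i_0}\sigma_{i_0}^\ell, & n>i_0,\end{cases}$$ where $$u_k=\begin{cases}\displaystyle\sum_{j=i_0-1}^k\frac{F_k^{(j)}}{q_{j,j+1}}\,q_{ji_0}(1-\delta_{ji_0}), & k\ge i_0,\\ 1,& k=i_0-1,\\ 0,& 0\le k\le i_0-2,\end{cases}\qquad v_k^{(\ell)}=\sum_{j=0}^k\frac{F_k^{(j)}}{q_{j,j+1}}\mathbb E_j\sigma_{i_0}^{\ell-1},\quad k\ge 0,$$ (terms with index $j=-1$ or $k=-1$ being omitted if $i_0=0$), and $$\mathbb E_{i_0}\sigma_{i_0}^\ell=\ell\varlimsup_{n\to\infty}\frac{\sum_{i_0\le k\le n}v_k^{(\ell)}}{1+\sum_{i_0\le k\le n}u_k},$$ which equals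 $\ell\lim_{n\to\infty}v_n^{(\ell)}/u_n$ if the latter limit exists.
   Context: A single birth $Q$-matrix on $\mathbb Z_+=\{0,1,2,\dots\}$ is a real matrix $Q=(q_{ij})$ with $q_{ij}\ge 0$ for $i\neq j$, which is conservative ($\sum_j q_{ij}=0$ for every $i$), irreducible, and satisfies $q_{i,i+1}>0$ and $q_{i,i+j}=0$ for all $i\in\mathbb Z_+$ and $j\ge 2$. $X(t)$ is the corresponding continuous-time Markov chain, $\mathbb E_n$ is expectation for the chain started at $n$, and $\sigma_{i_0}=\inf\{t\ge\eta_1:X(t)=i_0\}$, where $\eta_1$ is the first jump time. $\delta$ is the Kronecker delta. Define $q_n^{(k)}=\sum_{j=0}^kq_{nj}$ for $0\le k<n$, and $$F_i^{(i)}=1,\qquad F_n^{(i)}=\frac1{q_{n,n+1}}\sum_{k=i}^{n-1}q_n^{(k)}F_k^{(i)},\qquad n>i\ge 0.$$ Empty sums are $0$; the moments may be $+\infty$, with the convention $0\cdot\infty=0$; $\mathbb E_j\sigma_{i_0}^0=1$. *)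

(* Defs.v *)
From mathcomp Require Import all_boot all_order all_algebra.
From mathcomp Require Import all_classical all_reals all_analysis.

Set Implicit Arguments.
Unset Strict Implicit.
Unset Printing Implicit Defensive.

Import Order.TTheory GRing.Theory Num.Theory.
Import numFieldNormedType.Exports.

Local Open Scope classical_set_scope.
Local Open Scope ring_scope.

(* Diagonal entries of a conservative Q-matrix are nonpositive, so the rates
   along the path in [sb_irreducible] are automatically off-diagonal. *)
Record single_birth_Qmatrix (R : realType) (Q : nat -> nat -> R) : Prop := {
  sb_offdiag_ge0 : forall i j, i != j -> 0 <= Q i j;
  sb_conservative : forall i, series (Q i) n @[n --> \oo] --> (0 : R);
  sb_irreducible : forall i j, exists2 p : seq nat,
    path (fun a b => 0 < Q a b) i p & last i p = j;
  sb_birth_gt0 : forall i, 0 < Q i i.+1;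
  sb_birth_single : forall i j, (2 <= j)%N -> Q i (i + j)%N = 0
}.

Section coefficients.
Variables (R : realType) (Q : nat -> nat -> R).

Definition qsum (n k : nat) : R := \sum_(0 <= j < k.+1) Q n j.

(* The sequence F_i^(i), ..., F_(i+m)^(i). *)
Fixpoint Fseq (i m : nat) : seq R :=
  if m is m'.+1 then
    rcons (Fseq i m')
      ((Q (i + m)%N (i + m)%N.+1)^-1 *
       \sum_(i <= k < i + m) qsum (i + m)%N k * nth 0 (Fseq i m') (k - i)%N)
  else [:: 1].

(* [F n i] is F_n^(i), meaningful for i <= n; the lemmas [F_diag] and [F_rec]
   give the recursion that defines it. *)
Definition F (n i : nat) : R := nth 0 (Fseq i (n - i)) (n - i).

Lemma size_Fseq i m : size (Fseq i m) = m.+1.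
Proof. by elim: m => //= m IH; rewrite size_rcons IH. Qed.

Lemma nth_Fseq i m k : (k <= m)%N -> nth 0 (Fseq i m) k = F (i + k)%N i.
Proof.
rewrite /F addKn; elim: m => [|m IH] km; first by move: km; rewrite leqn0 => /eqP->.
move: km; rewrite leq_eqVlt => /predU1P[->//|km].
by rewrite [Fseq i m.+1]/= nth_rcons size_Fseq km IH.
Qed.

Lemma F_diag i : F i i = 1.
Proof. by rewrite /F subnn. Qed.

Lemma F_rec n i : (i < n)%N ->
  F n i = (Q n n.+1)^-1 * \sum_(i <= k < n) qsum n k * F k i.
Proof.
move=> ltin; have [m nE] : exists m, n = (i + m.+1)%N.
  by exists (n - i).-1; rewrite prednK ?subn_gt0// subnKC// ltnW.
rewrite {1}/F nE addKn [Fseq i m.+1]/= nth_rcons size_Fseq ltnn eqxx.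
congr (_ * _); apply: eq_big_nat => k /andP[ik kn]; congr (_ * _).
by rewrite nth_Fseq ?subnKC// leq_subLR -ltnS -addnS.
Qed.

(* For i0 = 0, [i0.-1] is 0, so the omitted index -1 is never reached. *)
Definition u (i0 k : nat) : R :=
  if (i0 <= k)%N then
    \sum_(i0.-1 <= j < k.+1) F k j / Q j j.+1 * Q j i0 * (1 - (j == i0)%:R)
  else if k.+1 == i0 then 1 else 0.

(* Here [M j] stands for the moment of order l - 1 started from j. *)
Definition v (M : nat -> \bar R) (k : nat) : \bar R :=
  (\sum_(0 <= j < k.+1) (F k j / Q j j.+1)%:E * M j)%E.

End coefficients.

Section process.
Variables (R : realType) (Q : nat -> nat -> R).

Definition exit_rate (i : nat) : R := - Q i i.

Definition jump_prob (i j : nat) : R :=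
  if i == j then 0 else Q i j / exit_rate i.

Context (d : measure_display) (T : measurableType d).
Variables (P : nat -> probability T R) (Y : nat -> T -> nat) (S : nat -> T -> R).

(* Under [P n], [Y] is the embedded jump chain, started at n, and [S] is the
   sequence of holding times of the (minimal) chain with Q-matrix [Q]: given
   the jump chain, the holding times are independent, S_k being exponential
   with parameter [exit_rate (Y k)].  Every exit rate is positive for a single
   birth Q-matrix, so there are no absorbing states. *)
Record jump_holding_realization : Prop := {
  jh_measurable_chain : forall k, measurable_fun [set: T] (Y k);
  jh_measurable_holding : forall k, measurable_fun [set: T] (S k);
  jh_holding_gt0 : forall k w, 0 < S k w;
  jh_law : forall (n m : nat) (y : nat -> nat) (t : nat -> R),
    (forall k, 0 <= t k) ->
    P n [set w | forall k, (k <= m)%N -> Y k w = y k /\ t k < S k w] =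
      ((y 0%N == n)%:R * \prod_(0 <= k < m) jump_prob (y k) (y k.+1) *
       \prod_(0 <= k < m.+1) expR (- (exit_rate (y k) * t k)))%:E
}.

(* [jump_time k] is eta_k, with eta_0 = 0. *)
Definition jump_time (k : nat) (w : T) : R := \sum_(0 <= i < k) S i w.

Definition explosion_time (w : T) : \bar R :=
  ereal_sup [set (jump_time k w)%:E | k in [set: nat]].

Definition nonexplosive : Prop :=
  forall n, {ae P n, forall w, explosion_time w = +oo%E}.

(* The chain X(t); it sits at the cemetery [None] from the explosion time on. *)
Definition X (t : R) (w : T) : option nat :=
  xget None [set o | exists k,
    jump_time k w <= t < jump_time k.+1 w /\ o = Some (Y k w)].

(* The infimum of the empty set is +oo. *)
Definition return_time (i0 : nat) (w : T) : \bar R :=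
  ereal_inf [set t%:E | t in [set t | jump_time 1 w <= t /\ X t w = Some i0]].

(* E_n sigma_i0^m; it is 1 for m = 0, even where sigma_i0 is infinite. *)
Definition moment (i0 m n : nat) : \bar R :=
  (\int[P n]_w (return_time i0 w ^+ m))%E.

End process.

(* Main.v *)
(* Let eta_k be the jump times, N the step at which the chain returns to i0, and
   x_m^l(i) = E_i[eta_(min(N,m))^l].  Conditioning on the first jump, whose time
   is exponential, gives
     x_(m+1)^l(i) = (l / q_i) x_(m+1)^(l-1)(i) + sum_(k <> i0) p_ik x_m^l(k),
   and x_m^l increases to the l-th moment of the return time: either N < oo
   almost surely, because the previous moment is finite, or l = 1 and the
   process does not explode.  So the moments are the minimal nonnegative
   solution of f = l M / q + sum_(k <> i0) p_ik f(k).  Summing by parts, the real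
   solutions of this equation are the affine family displayed in the theorem,
   indexed by c = f(i0), and minimality makes E_i0 the smallest c for which the
   solution is nonnegative, that is, l times the supremum of the ratios
   sum v / (1 + sum u).  Since all moments are positive the supremum is not
   attained, hence it is the limsup.

   The last claim is Stolz-Cesaro when sum u = oo.  If E_i0 is finite this must
   hold: h = 1 + sum u is harmonic for the chain killed at i0, so if it were
   bounded, h(i0) = 1 would be at most a constant times P_i0(N > m) for every m,
   which tends to 0.  If E_i0 is infinite, a finite limit of v / u would bound
   the ratios. *)
Require Import Defs.
From mathcomp Require Import all_boot all_order all_algebra.
From mathcomp Require Import all_classical all_reals all_analysis.
From mathcomp Require Import measurable_realfun.
From mathcomp Require Import ring lra zify.
Set Implicit Arguments.
Unset Strict Implicit.
Unset Printing Implicit Defensive.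
Import Order.TTheory GRing.Theory Num.Theory.
Import numFieldNormedType.Exports.
Local Open Scope classical_set_scope.
Local Open Scope ring_scope.

(** * The linear equation of a single birth matrix *)

Lemma sum_nat_triangle (V : nmodType) n (f : nat -> nat -> V) :
  \sum_(0 <= k < n) \sum_(0 <= j < k.+1) f k j =
  \sum_(0 <= j < n) \sum_(j <= k < n) f k j.
Proof.
elim: n => [|n IH]; first by rewrite !big_nil.
rewrite big_nat_recr//= IH [RHS]big_nat_recr//= big_nat1 big_nat_recr//= addrA.
rewrite -big_split/=; congr (_ + _); apply: eq_big_nat => j /andP[_ jn].
by rewrite big_nat_recr//= ltnW.
Qed.

Section single_birth_rates.
Variables (R : realType) (Q : nat -> nat -> R).
Hypothesis hQ : single_birth_Qmatrix Q.

Lemma sb_far i k : (i.+1 < k)%N -> Q i k = 0.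
Proof.
move=> ik; have -> : k = (i + (k - i))%N by lia.
by apply: (sb_birth_single hQ); lia.
Qed.

Lemma sb_row_sum i : \sum_(0 <= k < i.+2) Q i k = 0.
Proof.
have h := sb_conservative hQ i.
apply: (cvg_unique _ _ h) => //.
apply: cvg_near_cst; exists i.+2 => // n /= le_in.
rewrite /series/= (big_cat_nat _ le_in)//= [X in _ + X]big_nat.
rewrite [X in _ + X]big1 ?addr0// => k /andP[ik _]; exact: sb_far.
Qed.

Lemma qsum_ge0 n k : (k < n)%N -> 0 <= qsum Q n k.
Proof.
move=> kn; rewrite /qsum big_nat; apply: sumr_ge0 => j /andP[_ jk].
by apply: (sb_offdiag_ge0 hQ); lia.
Qed.

Lemma exit_rate_gt0 i : 0 < exit_rate Q i.
Proof.
have := sb_row_sum i; rewrite big_nat_recr//= big_nat_recr//= => h.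
have h1 := sb_birth_gt0 hQ i.
have h2 : 0 <= \sum_(0 <= k < i) Q i k.
  by rewrite big_nat; apply: sumr_ge0 => j ?; apply: (sb_offdiag_ge0 hQ); lia.
rewrite /exit_rate; lra.
Qed.

Lemma jump_prob_ge0 i k : 0 <= jump_prob Q i k.
Proof.
rewrite /jump_prob; case: eqVneq => // ik.
by rewrite divr_ge0 ?(sb_offdiag_ge0 hQ)// ltW// exit_rate_gt0.
Qed.

Lemma jump_prob_far i k : (i.+1 < k)%N -> jump_prob Q i k = 0.
Proof. by move=> ik; rewrite /jump_prob sb_far// mul0r if_same. Qed.

Lemma jump_prob_birth_gt0 i : 0 < jump_prob Q i i.+1.
Proof.
by rewrite /jump_prob ifF ?divr_gt0 ?exit_rate_gt0 ?(sb_birth_gt0 hQ)//; lia.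
Qed.

Lemma sum_jump_prob i : \sum_(0 <= k < i.+2) jump_prob Q i k = 1.
Proof.
have q0 := lt0r_neq0 (exit_rate_gt0 i).
have := sb_row_sum i; rewrite big_nat_recr//= big_nat_recr//= => h.
rewrite big_nat_recr//= big_nat_recr//= {2}/jump_prob eqxx addr0.
rewrite {2}/jump_prob ifF; last by lia.
under eq_big_nat => k ki.
  rewrite /jump_prob ifF; last by lia.
  over.
rewrite -mulr_suml -mulrDl; have -> : \sum_(0 <= k < i) Q i k + Q i i.+1 = exit_rate Q i.
  by rewrite /exit_rate; lra.
by rewrite divff.
Qed.

Lemma F_ge0 n i : (i <= n)%N -> 0 <= F Q n i.
Proof.
elim/ltn_ind: n => n IH; rewrite leq_eqVlt => /predU1P[->|lt_in].
  by rewrite F_diag.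
rewrite F_rec// mulr_ge0 ?invr_ge0 ?(ltW (sb_birth_gt0 hQ _))//.
rewrite big_nat; apply: sumr_ge0 => k /andP[ik kn].
by rewrite mulr_ge0 ?qsum_ge0 ?IH.
Qed.

Lemma sum_row_by_parts n (f : nat -> R) :
  \sum_(0 <= k < n.+2) Q n k * f k = Q n n.+1 * (f n.+1 - f n)
    - \sum_(0 <= k < n) qsum Q n k * (f k.+1 - f k).
Proof.
have parts m : \sum_(0 <= k < m.+1) Q n k * f k =
    qsum Q n m * f m - \sum_(0 <= k < m) qsum Q n k * (f k.+1 - f k).
  elim: m => [|m IH]; first by rewrite big_nat1 big_nil subr0 /qsum big_nat1.
  rewrite big_nat_recr//= IH [in RHS]big_nat_recr//= [qsum Q n m.+1]big_nat_recr//=.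
  rewrite -/(qsum Q n m); ring.
have := sb_row_sum n; rewrite -/(qsum Q n n.+1) => h.
rewrite parts h mul0r sub0r big_nat_recr//=.
have : qsum Q n n + Q n n.+1 = 0 by rewrite -h [RHS]big_nat_recr.
move=> /eqP; rewrite addr_eq0 => /eqP->; ring.
Qed.

Definition birth_solution (g : nat -> R) n :=
  \sum_(0 <= j < n.+1) F Q n j / Q j j.+1 * g j.

Lemma birth_solutionE (g : nat -> R) n :
  Q n n.+1 * birth_solution g n =
    \sum_(0 <= k < n) qsum Q n k * birth_solution g k + g n.
Proof.
have qn := lt0r_neq0 (sb_birth_gt0 hQ n).
rewrite /birth_solution big_nat_recr//= mulrDr; congr (_ + _); last first.
  by rewrite F_diag; field.
rewrite mulr_sumr.
under [RHS]eq_bigr do rewrite mulr_sumr.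
rewrite sum_nat_triangle; apply: eq_big_nat => j /andP[_ jn].
rewrite F_rec// !mulrA divff// mul1r -mulrA mulr_suml.
by apply: eq_bigr => k _; rewrite !mulrA.
Qed.

Lemma birth_solution_unique (g w : nat -> R) N :
  (forall n, (n < N)%N ->
    Q n n.+1 * w n = \sum_(0 <= k < n) qsum Q n k * w k + g n) ->
  forall n, (n < N)%N -> w n = birth_solution g n.
Proof.
move=> wE; elim/ltn_ind => n IH nN.
have qn := lt0r_neq0 (sb_birth_gt0 hQ n).
apply: (mulfI qn); rewrite wE// birth_solutionE; congr (_ + _).
apply: eq_big_nat => k /andP[_ kn]; rewrite IH//; exact: ltn_trans nN.
Qed.

End single_birth_rates.

Section killed_equation.
Variables (R : realType) (Q : nat -> nat -> R) (i0 : nat).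
Hypothesis hQ : single_birth_Qmatrix Q.

Definition killed (f : nat -> R) i : R :=
  \sum_(0 <= k < i.+2 | k != i0) jump_prob Q i k * f k.

Lemma killed_le (f h : nat -> R) i :
  (forall k, (k < i.+2)%N -> k != i0 -> f k <= h k) -> killed f i <= killed h i.
Proof.
move=> fh; rewrite /killed big_nat_cond [leRHS]big_nat_cond; apply: ler_sum.
by move=> k /andP[/andP[_ ki] ki0]; rewrite ler_wpM2l ?jump_prob_ge0 ?fh.
Qed.

Lemma killed_ge0 (f : nat -> R) i : (forall k, 0 <= f k) -> 0 <= killed f i.
Proof. by move=> f0; apply: sumr_ge0 => k _; rewrite mulr_ge0 ?jump_prob_ge0. Qed.

Lemma eq_killed (f h : nat -> R) i :
  (forall k, (k < i.+2)%N -> k != i0 -> f k = h k) -> killed f i = killed h i.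
Proof.
move=> fh; rewrite /killed big_nat_cond [RHS]big_nat_cond.
by apply: eq_bigr => k /andP[/andP[_ ki] ki0]; rewrite fh.
Qed.

Lemma exit_rate_killed (f : nat -> R) i : exit_rate Q i * killed f i =
  \sum_(0 <= k < i.+2) Q i k * f k + exit_rate Q i * f i
  - Q i i0 * (1 - (i == i0)%:R) * f i0.
Proof.
have q0 := lt0r_neq0 (exit_rate_gt0 hQ i).
have one k0 c : (k0 < i.+2)%N -> \sum_(0 <= k < i.+2) (k == k0)%:R * c = c :> R.
  move=> k0i; rewrite (bigD1_seq k0) ?mem_index_iota ?iota_uniq//= eqxx mul1r.
  by rewrite big1 ?addr0// => k /negPf->; rewrite mul0r.
have -> : Q i i0 * (1 - (i == i0)%:R) * f i0 =
    \sum_(0 <= k < i.+2) (k == i0)%:R * (Q i i0 * (1 - (i == i0)%:R) * f i0).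
  have [i0i|ii0] := ltnP i0 i.+2; first by rewrite one.
  by rewrite (sb_far hQ)// !mul0r big1// => k _; rewrite mulr0.
rewrite -[exit_rate Q i * f i](one i (exit_rate Q i * f i))// -big_split -sumrB/=.
rewrite /killed mulr_sumr big_mkcond/=; apply: eq_bigr => k _.
rewrite /jump_prob (eq_sym i k); case: (eqVneq k i0) => [->|ki0]; last first.
  case: (eqVneq k i) => [->|ki] /=; last by field.
  by rewrite /exit_rate mulr1n mulr0n; ring.
case: (eqVneq i0 i) => [->|ii0] /=; first by rewrite /exit_rate mulr1n; ring.
by rewrite mulr1n mulr0n; field.
Qed.

Lemma killed_eqP (g f : nat -> R) i :
  f i = g i / exit_rate Q i + killed f i <->
  \sum_(0 <= k < i.+2) Q i k * f k = Q i i0 * (1 - (i == i0)%:R) * f i0 - g i.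
Proof.
have q0 := lt0r_neq0 (exit_rate_gt0 hQ i).
have h := exit_rate_killed f i; split=> e.
  have : exit_rate Q i * f i = g i + exit_rate Q i * killed f i.
    by rewrite [in LHS]e; field.
  by move: h; lra.
by apply: (mulfI q0); rewrite mulrDr mulrCA divff// mulr1; move: h e; lra.
Qed.

Lemma uE n : u Q i0 n = birth_solution Q (fun j => Q j i0 * (1 - (j == i0)%:R)) n.
Proof.
have Q0 j : (j.+1 < i0)%N -> Q j i0 = 0 by exact: (sb_far hQ).
rewrite /u /birth_solution; case: ifPn => [i0n|].
  rewrite [RHS](@big_cat_nat _ _ _ i0.-1 0 n.+1)//=; last by lia.
  rewrite [X in _ = X + _]big_nat [X in _ = X + _]big1 ?add0r; last first.
    by move=> j ?; rewrite Q0 ?mul0r ?mulr0//; lia.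
  by apply: eq_bigr => j _; rewrite mulrA.
case: eqVneq => [e _|ni0 lt_i0n].
  rewrite big_nat_recr//= big_nat big1 ?add0r; last first.
    by move=> j ?; rewrite Q0 ?mul0r ?mulr0//; lia.
  rewrite F_diag -e ltn_eqF//= mulr0n subr0 mulr1.
  have := lt0r_neq0 (sb_birth_gt0 hQ n) => ?; by rewrite mul1r mulVf.
rewrite big_nat big1// => j ?; rewrite Q0 ?mul0r ?mulr0//; lia.
Qed.

Lemma F_div_ge0 n j : (j <= n)%N -> 0 <= F Q n j / Q j j.+1.
Proof. by move=> jn; rewrite divr_ge0 ?(F_ge0 hQ)// ltW// (sb_birth_gt0 hQ). Qed.

Lemma u_ge0 n : 0 <= u Q i0 n.
Proof.
rewrite uE /birth_solution big_nat; apply: sumr_ge0 => j jn.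
rewrite mulr_ge0 ?F_div_ge0//.
case: eqVneq => [->|ji]; first by rewrite subrr mulr0.
by rewrite subr0 mulr1 (sb_offdiag_ge0 hQ).
Qed.

Lemma sum_u_before n : (n < i0)%N -> \sum_(n <= k < i0) u Q i0 k = 1.
Proof.
move=> ni; have -> : i0 = i0.-1.+1 by lia.
rewrite big_nat_recr/=; last by lia.
rewrite big_nat big1 ?add0r /u; last first.
  by move=> k ?; rewrite !ifF//; lia.
by rewrite ifF ?ifT//; lia.
Qed.

Definition killed_solution (g : nat -> R) (c : R) n : R :=
  if (n <= i0)%N
  then \sum_(n <= k < i0) birth_solution Q g k + (1 - \sum_(n <= k < i0) u Q i0 k) * c
  else - (\sum_(i0 <= k < n) birth_solution Q g k)
       + (1 + \sum_(i0 <= k < n) u Q i0 k) * c.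

Lemma killed_solution_i0 g c : killed_solution g c i0 = c.
Proof. by rewrite /killed_solution leqnn !big_geq// add0r subr0 mul1r. Qed.

Lemma killed_solution_before g c n : (n < i0)%N ->
  killed_solution g c n = \sum_(n <= k < i0) birth_solution Q g k.
Proof.
by move=> ni; rewrite /killed_solution ltnW// sum_u_before// subrr mul0r addr0.
Qed.

Lemma birth_solution_ge0 g n : (forall i, 0 <= g i) -> 0 <= birth_solution Q g n.
Proof.
move=> g0; rewrite /birth_solution big_nat; apply: sumr_ge0 => j jn.
by rewrite mulr_ge0 ?F_div_ge0.
Qed.

Lemma birth_solution_gt0 g n : (forall i, 0 < g i) -> 0 < birth_solution Q g n.
Proof.
move=> g0; rewrite /birth_solution big_nat_recr//= F_diag; apply: ltr_wpDl.
  rewrite big_nat; apply: sumr_ge0 => j jn.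
  by rewrite mulr_ge0 ?F_div_ge0// ?ltW//; lia.
by rewrite !mulr_gt0 ?invr_gt0// (sb_birth_gt0 hQ).
Qed.

Lemma birth_solution_affine (a g : nat -> R) c n :
  birth_solution Q (fun j => a j * c - g j) n =
  birth_solution Q a n * c - birth_solution Q g n.
Proof.
rewrite /birth_solution mulr_suml -sumrB; apply: eq_bigr => j _; ring.
Qed.

Lemma killed_solution_step g c n :
  killed_solution g c n.+1 - killed_solution g c n =
  birth_solution Q (fun j => Q j i0 * (1 - (j == i0)%:R) * c - g j) n.
Proof.
rewrite birth_solution_affine -uE /killed_solution.
case: (ltngtP n i0) => [ni|ni|->].
- by rewrite [in X in _ - (X + _)]big_ltn// [in X in _ - (_ + (_ - X) * _)]big_ltn//; ring.
- have recr (a : nat -> R) :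
      \sum_(i0 <= k < n.+1) a k = \sum_(i0 <= k < n) a k + a n.
    by rewrite big_nat_recr// ltnW.
  by rewrite 2!recr; ring.
- by rewrite !big_nat1 !big_geq//; ring.
Qed.

Lemma killed_solutionP g c i : killed_solution g c i =
  g i / exit_rate Q i + killed (killed_solution g c) i.
Proof.
apply/killed_eqP; rewrite (sum_row_by_parts hQ) killed_solution_step.
rewrite (birth_solutionE hQ) killed_solution_i0.
under [X in _ - X]eq_bigr do rewrite killed_solution_step.
by ring.
Qed.

Lemma killed_solution_unique (g f : nat -> R) N : (i0 <= N)%N ->
  (forall i, (i < N)%N -> f i = g i / exit_rate Q i + killed f i) ->
  forall n, (n <= N)%N -> f n = killed_solution g (f i0) n.
Proof.
move=> i0N fE.
have step n : (n < N)%N ->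
    f n.+1 - f n = killed_solution g (f i0) n.+1 - killed_solution g (f i0) n.
  move=> nN; rewrite killed_solution_step.
  apply: (birth_solution_unique hQ (w := fun n => f n.+1 - f n) _ nN) => {nN}n nN.
  by move/killed_eqP: (fE _ nN); rewrite (sum_row_by_parts hQ) => /eqP; rewrite subr_eq
    => /eqP->; ring.
have up n m : (n <= m)%N -> (m <= N)%N ->
    f m - f n = killed_solution g (f i0) m - killed_solution g (f i0) n.
  move=> nm mN; rewrite -!telescope_sumr//.
  by apply: eq_big_nat => k ?; apply: step; lia.
move=> n nN; have [ni0|i0n] := leqP n i0.
  by have := up _ _ ni0 i0N; rewrite killed_solution_i0 => /addrI/oppr_inj.
by have := up _ _ (ltnW i0n) nN; rewrite killed_solution_i0 => /addIr.
Qed.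

Lemma killed_minimal (g : nat -> R) (gm x : nat -> nat -> R) (A : pred nat) (f : nat -> R) :
  (forall i, x 0%N i = 0) ->
  (forall m i, x m.+1 i = gm m i / exit_rate Q i + killed (x m) i) ->
  (forall m i, gm m i <= g i) ->
  (forall i, A i -> 0 <= f i) ->
  (forall i, A i -> g i / exit_rate Q i + killed f i <= f i) ->
  (forall i k, A i -> (k < i.+2)%N -> k != i0 -> ~~ A k -> forall m, x m k <= f k) ->
  forall m i, A i -> x m i <= f i.
Proof.
move=> x0 xS gmg f0 fE bd; elim=> [|m IH] i Ai; first by rewrite x0 f0.
rewrite xS (le_trans _ (fE _ Ai))// lerD//.
  by rewrite ler_pM2r ?invr_gt0 ?exit_rate_gt0.
apply: killed_le => k ki ki0; have [Ak|Ak] := boolP (A k); first exact: IH.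
exact: (bd i).
Qed.

End killed_equation.

(** * The minimal nonnegative solution *)

Lemma lte_between (R : realFieldType) (a b : \bar R) : (a < b)%E ->
  exists2 c, (a < c%:E)%E & (c%:E < b)%E.
Proof.
case: a b => [a| |] [b| |]//.
- by rewrite lte_fin => ab; exists ((a + b) / 2); rewrite lte_fin; lra.
- by exists (a + 1); rewrite ?ltry// lte_fin; lra.
- by exists (b - 1); rewrite ?ltNyr// lte_fin; lra.
- by exists 0; rewrite ?ltry ?ltNyr.
Qed.

Section minimal_solution.
Variables (R : realType) (Q : nat -> nat -> R) (i0 : nat).
Hypothesis hQ : single_birth_Qmatrix Q.
Variables (g : nat -> R) (gm x : nat -> nat -> R) (E : nat -> \bar R).
Hypothesis g_gt0 : forall i, 0 < g i.
Hypothesis gm_ge0 : forall m i, 0 <= gm m i.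
Hypothesis gm_le : forall m i, gm m i <= g i.
Hypothesis gm_cvg : forall i, gm ^~ i @ \oo --> g i.
Hypothesis x0 : forall i, x 0 i = 0.
Hypothesis xS : forall m i,
  x m.+1 i = gm m i / exit_rate Q i + killed Q i0 (x m) i.
Hypothesis x_nd : forall i, nondecreasing_seq (x ^~ i).
Hypothesis x_cvg : forall i, (x m i)%:E @[m --> \oo] --> E i.

Let V := birth_solution Q g.
Let e i := fine (E i).

Let q_gt0 := exit_rate_gt0 hQ.

Lemma minsol_iter_ge0 m i : 0 <= x m i.
Proof. by rewrite -(x0 i); exact: x_nd. Qed.

Lemma minsolE i : E i = limn (fun m => (x m i)%:E).
Proof. by apply/esym/cvg_lim => //; exact: x_cvg. Qed.

Lemma minsol_iter_le m i : ((x m i)%:E <= E i)%E.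
Proof.
rewrite minsolE; apply: lime_ge; first by apply/cvg_ex; exists (E i); exact: x_cvg.
by exists m => // k /= mk; rewrite lee_fin; exact: x_nd.
Qed.

Lemma minsol_le i c : (forall m, x m i <= c) -> (E i <= c%:E)%E.
Proof.
move=> xc; rewrite minsolE; apply: lime_le.
  by apply/cvg_ex; exists (E i); exact: x_cvg.
by apply: nearW => m; rewrite lee_fin.
Qed.

Lemma minsol_ge0 i : (0 <= E i)%E.
Proof. by apply: le_trans (minsol_iter_le 0 i); rewrite lee_fin minsol_iter_ge0. Qed.

Lemma minsol_fin i : (E i < +oo)%E -> E i = (e i)%:E.
Proof. by move=> Ei; rewrite fineK// ge0_fin_numE// minsol_ge0. Qed.

Lemma minsol_iter_le_fin m i : (E i < +oo)%E -> x m i <= e i.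
Proof. by move=> Ei; rewrite -lee_fin -minsol_fin// minsol_iter_le. Qed.

Lemma minsol_iter_cvg_fin i : (E i < +oo)%E -> x ^~ i @ \oo --> e i.
Proof. by move=> Ei; have := @x_cvg i; rewrite (minsol_fin Ei) => /fine_cvg. Qed.

Lemma minsol_eq i : (forall k, (k < i.+2)%N -> k != i0 -> (E k < +oo)%E) ->
  E i = (g i / exit_rate Q i + killed Q i0 e i)%:E.
Proof.
move=> fin; have h1 : x m.+1 i @[m --> \oo] -->
    g i / exit_rate Q i + killed Q i0 e i.
  under eq_fun do rewrite xS; apply: cvgD; first by apply: cvgMr_tmp; exact: gm_cvg.
  rewrite /killed [X in _ --> X]big_nat_cond.
  under eq_fun do rewrite /killed big_nat_cond.
  apply: cvg_big => [|k /andP[/andP[_ ki] ki0]]; first exact: add_continuous.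
  by apply: cvgMl_tmp; apply: minsol_iter_cvg_fin; exact: fin.
have h2 : (x m.+1 i)%:E @[m --> \oo] --> E i.
  by have := @x_cvg i; rewrite -cvg_shiftS.
apply: (cvg_unique _ h2) => //; apply: cvg_EFin; last exact: h1.
by apply: nearW.
Qed.

Lemma minsol_gt0 i : (0 < E i)%E.
Proof.
have : (0 < (g i / exit_rate Q i)%:E)%E by rewrite lte_fin divr_gt0.
move/lt_le_trans; apply; have [Ei|] := ltP (E i) +oo%E; last first.
  by rewrite leye_eq => /eqP->; rewrite leey.
rewrite (minsol_fin Ei) lee_fin.
have h : gm m i / exit_rate Q i @[m --> \oo] --> g i / exit_rate Q i.
  by apply: cvgMr_tmp; exact: gm_cvg.
rewrite -(cvg_lim _ h)//; apply: limr_le; first by apply/cvg_ex; eexists; exact: h.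
apply: nearW => m; rewrite (le_trans _ (minsol_iter_le_fin m.+1 Ei))// xS lerDl.
by apply: killed_ge0 => // k; exact: minsol_iter_ge0.
Qed.

Lemma minsol_succ i : i.+1 != i0 -> (E i < +oo -> E i.+1 < +oo)%E.
Proof.
move=> i1 Ei; have p0 := jump_prob_birth_gt0 hQ i.
apply: (@le_lt_trans _ _ (e i / jump_prob Q i i.+1)%:E); last exact: ltry.
apply: minsol_le => m; rewrite ler_pdivlMr// mulrC.
apply: (le_trans _ (minsol_iter_le_fin m.+1 Ei)); rewrite xS.
apply: ler_wpDl; first by rewrite mulr_ge0 ?invr_ge0 ?(ltW (q_gt0 i)).
rewrite /killed big_mkcond/= big_nat_recr//= i1 lerDr.
apply: sumr_ge0 => k _; case: ifP => // _.
by rewrite mulr_ge0 ?(jump_prob_ge0 hQ) ?minsol_iter_ge0.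
Qed.

Let V_ge0 n : 0 <= V n.
Proof. by apply: (birth_solution_ge0 hQ) => i; exact: ltW. Qed.

Let minimal A f := @killed_minimal R Q i0 hQ g gm x A f x0 xS gm_le.

Lemma minsol_before n : (n < i0)%N -> E n = (\sum_(n <= k < i0) V k)%:E.
Proof.
have fin k : (k < i0)%N -> (E k < +oo)%E.
  move=> ki0; apply: le_lt_trans (ltry (killed_solution Q i0 g 0 k)).
  apply: minsol_le => m; apply: (minimal (A := fun k => (k < i0)%N)) => //.
  - move=> i ii0; rewrite killed_solution_before//; exact: sumr_ge0.
  - by move=> i _; rewrite -(killed_solutionP i0 hQ).
  - by move=> i j ii0 ji ji0; lia.
pose f k := if (k < i0)%N then e k else 0.
move=> ni0; have -> : E n = (f n)%:E by rewrite /f ni0 minsol_fin// fin.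
rewrite (killed_solution_unique (i0 := i0) (N := i0) hQ (g := g) (f := f))//.
- by rewrite killed_solution_before.
- move=> i ii0; apply: EFin_inj; rewrite {1}/f ii0 -minsol_fin ?fin//.
  rewrite minsol_eq => [|k ki ki0]; last by apply: fin; lia.
  by congr (_ + _)%:E; apply: eq_killed => k ki ki0; rewrite /f ifT//; lia.
- exact: ltnW.
Qed.

Lemma minsol_after N : (i0 < N)%N -> (E N < +oo -> E i0 < +oo)%E.
Proof.
move=> i0N EN; pose c := e N + \sum_(i0 <= k < N) V k.
have eN : 0 <= e N by rewrite -lee_fin -minsol_fin// minsol_ge0.
have c0 : 0 <= c by rewrite addr_ge0// sumr_ge0.
have bd n : (i0 < n)%N -> (n <= N)%N -> e N <= killed_solution Q i0 g c n.
  move=> i0n nN; rewrite /killed_solution leqNgt i0n/= mulrDl mul1r.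
  have uc : 0 <= (\sum_(i0 <= k < n) u Q i0 k) * c.
    by rewrite mulr_ge0// sumr_ge0// => k _; exact: u_ge0.
  have Vc : \sum_(i0 <= k < n) V k <= \sum_(i0 <= k < N) V k.
    by rewrite [leRHS](@big_cat_nat _ _ _ n)//=; [rewrite lerDl sumr_ge0|exact: ltnW].
  rewrite {1}/c; move: uc Vc; rewrite /V; lra.
apply: le_lt_trans (ltry (killed_solution Q i0 g c i0)).
apply: minsol_le => m; apply: (minimal (A := fun k => (k < N)%N)) => //.
- move=> i iN; have [ii0|i0i] := leqP i i0; last by rewrite (le_trans eN)// bd// ltnW.
  move: ii0; rewrite leq_eqVlt => /predU1P[->|ii0]; first by rewrite killed_solution_i0.
  by rewrite killed_solution_before//; exact: sumr_ge0.
- by move=> i _; rewrite -(killed_solutionP i0 hQ).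
- move=> i k iN ki ki0; rewrite -leqNgt => Nk m'.
  have -> : k = N by lia.
  by rewrite (le_trans (minsol_iter_le_fin m' EN))// bd.
Qed.

Lemma minsol_all_fin n : (E i0 < +oo -> E n < +oo)%E.
Proof.
move=> Ei0; have [ni0|i0n] := ltnP n i0; first by rewrite minsol_before// ltry.
rewrite -(subnKC i0n); elim: (n - i0)%N => [|k IH]; first by rewrite addn0.
by rewrite addnS; apply: minsol_succ => //; lia.
Qed.

Lemma minsol_solution n : (E i0 < +oo)%E -> E n = (killed_solution Q i0 g (e i0) n)%:E.
Proof.
move=> Ei0; rewrite (minsol_fin (minsol_all_fin n Ei0)); congr (_%:E).
apply: (killed_solution_unique hQ (N := maxn i0 n)); rewrite ?leq_maxl ?leq_maxr//.
move=> i _; apply: EFin_inj; rewrite -(minsol_fin (minsol_all_fin i Ei0)).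
by apply: minsol_eq => k _ _; exact: minsol_all_fin.
Qed.

Let Vs n := \sum_(i0 <= k < n.+1) V k.
Let Hs n := 1 + \sum_(i0 <= k < n.+1) u Q i0 k.

Let Hs_ge1 n : 1 <= Hs n.
Proof. by rewrite lerDl sumr_ge0// => k _; exact: u_ge0. Qed.

Let Hs_gt0 n : 0 < Hs n. Proof. exact: lt_le_trans (Hs_ge1 n). Qed.

Lemma minsol_le_ratio C : (forall n, Vs n / Hs n <= C) -> (E i0 <= C%:E)%E.
Proof.
move=> VC; have C0 : 0 <= C.
  by apply: le_trans (VC 0%N); rewrite divr_ge0 ?(ltW (Hs_gt0 _))// sumr_ge0.
apply: minsol_le => m; rewrite -[leRHS](killed_solution_i0 Q i0 g).
apply: (minimal (A := predT)) => // [i _|i _]; last by rewrite -(killed_solutionP i0 hQ).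
have [ii0|i0i] := leqP i i0; last first.
  rewrite /killed_solution leqNgt i0i/=; case: i i0i => // i i0i.
  by have := VC i; rewrite ler_pdivrMr// /Vs /Hs /V mulrC; lra.
move: ii0; rewrite leq_eqVlt => /predU1P[->|ii0]; first by rewrite killed_solution_i0.
by rewrite killed_solution_before//; exact: sumr_ge0.
Qed.

Lemma ratio_lt_minsol n : ((Vs n / Hs n)%:E < E i0)%E.
Proof.
have [Ei0|] := ltP (E i0) +oo%E; last by rewrite leye_eq => /eqP->; rewrite ltry.
have [i0n|ni0] := leqP i0 n; last by rewrite /Vs big_geq// mul0r minsol_gt0.
have := minsol_gt0 n.+1; rewrite minsol_solution// /killed_solution leqNgt ltnS i0n/=.
by rewrite (minsol_fin Ei0) !lte_fin ltr_pdivrMr// mulrC /Hs /Vs /V; lra.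
Qed.

Lemma ratio_eventually_le C : (\forall n \near \oo, Vs n / Hs n <= C) ->
  (E i0 <= C%:E)%E.
Proof.
move=> [n0 _ VC]; rewrite leNgt; apply/negP => CE.
have [D DE bd] : exists2 D, (D%:E < E i0)%E & forall n, (n < n0)%N -> Vs n / Hs n <= D.
  elim: n0 {VC} => [|n0 [D DE bd]]; first by exists C.
  exists (Num.max D (Vs n0 / Hs n0)).
    by rewrite EFin_max gt_max DE ratio_lt_minsol.
  by move=> n; rewrite ltnS leq_eqVlt le_max => /predU1P[->|/bd->//]; rewrite lexx orbT.
suff : (E i0 <= (Num.max C D)%:E)%E by rewrite leNgt EFin_max gt_max CE DE.
apply: minsol_le_ratio => n; rewrite le_max; have [nn0|n0n] := ltnP n n0.
  by rewrite bd ?orbT.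
by rewrite VC.
Qed.

Lemma minsol_limn_esup : E i0 = limn_esup (fun n => (Vs n / Hs n)%:E).
Proof.
apply/eqP; rewrite eq_le; apply/andP; split; last first.
  apply: (@le_trans _ _ (ereal_sup [set (Vs n / Hs n)%:E | n in setT])).
    by apply: ereal_inf_lbound; exists setT => //; exact: filterT.
  by apply: ge_ereal_sup => _ [n _ <-]; exact/ltW/ratio_lt_minsol.
rewrite leNgt; apply/negP => /ereal_inf_lt[_ [A nA <-]] sE.
have ub n : A n -> ((Vs n / Hs n)%:E <= ereal_sup [set (Vs n / Hs n)%:E | n in A])%E.
  by move=> An; apply: ereal_sup_ubound; exists n.
move: sE ub; case: (ereal_sup _) => [s sE ub|sE _|_ ub].
- have : (E i0 <= s%:E)%E.
    by apply: ratio_eventually_le; apply: filterS nA => n /ub; rewrite lee_fin.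
  by rewrite leNgt sE.
- by move: sE; rewrite ltNge leey.
- have [n An] : exists n, A n by case: nA => n0 _ A0; exists n0; apply: A0 => /=.
  by have := ub _ An; rewrite leeNy_eq.
Qed.

Lemma sum_u_unbounded_or_bounded : (forall B, exists n, B < Hs n) \/
  (exists B, forall n, `|killed_solution Q i0 (fun=> 0) 1 n| <= B).
Proof.
have [unb|] := pselect (forall B, exists n, B < Hs n); first by left.
move=> /existsNP[B /forallNP bd]; right; exists (Num.max 1 B) => n.
have V0 k : birth_solution Q (fun=> 0) k = 0.
  by rewrite /birth_solution big1// => j _; rewrite mulr0.
rewrite le_max /killed_solution; case: ltngtP => [ni0|i0n|->].
- by rewrite sum_u_before// subrr mul0r addr0 big1// normr0 ler01.
- rewrite mulr1 big1 ?oppr0 ?add0r//.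
  case: n i0n => // n i0n; rewrite -/(Hs n) ger0_norm ?(ltW (Hs_gt0 n))//.
  by have /negP := bd n; rewrite -leNgt => ->; rewrite orbT.
- by rewrite !big_geq// subr0 mulr1 add0r normr1 lexx.
Qed.

Hypothesis survival : (E i0 < +oo)%E ->
  iter m (killed Q i0) (fun=> 1) i0 @[m --> \oo] --> (0 : R).

Lemma sum_u_unbounded B : (E i0 < +oo)%E -> exists n, B < Hs n.
Proof.
move=> Ei0; have [//|[C hC]] := sum_u_unbounded_or_bounded; exfalso.
pose h := killed_solution Q i0 (fun=> 0) 1.
pose z m := iter m (killed Q i0) (fun=> 1).
have hz m i : h i <= C * z m i.
  elim: m i => [|m IH] i; first by rewrite mulr1 (le_trans _ (hC i))// ler_norm.
  rewrite /h (killed_solutionP i0 hQ) mul0r add0r.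
  rewrite [z m.+1 i]/= /killed mulr_sumr; apply: ler_sum => k _.
  by rewrite mulrCA ler_wpM2l ?(jump_prob_ge0 hQ)// IH.
have Cz : C * z m i0 @[m --> \oo] --> C * 0 by apply: cvgMl_tmp; exact: survival.
suff : 1 <= C * 0 by rewrite mulr0 ler10.
rewrite -[leRHS](cvg_lim _ Cz)//; apply: limr_ge.
  by apply/cvg_ex; eexists; exact: Cz.
by apply: nearW => m; rewrite -[leLHS](killed_solution_i0 Q i0 (fun=> 0)).
Qed.

Let r n := ((V n)%:E / (u Q i0 n)%:E)%E.

Let V_gt0 n : 0 < V n. Proof. exact: birth_solution_gt0. Qed.

Lemma ratio_leP C n : (r n <= C%:E)%E -> V n <= C * u Q i0 n.
Proof.
rewrite /r; have := u_ge0 i0 hQ n; rewrite le_eqVlt => /predU1P[<-|un].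
  by rewrite inve0 gt0_muley ?lte_fin// leye_eq.
by rewrite inver gt_eqF// -EFinM lee_fin ler_pdivrMr.
Qed.

Lemma ratio_geP C n : (C%:E <= r n)%E -> C * u Q i0 n <= V n.
Proof.
rewrite /r; have := u_ge0 i0 hQ n; rewrite le_eqVlt => /predU1P[<-|un].
  by rewrite mulr0 => _; exact: ltW.
by rewrite inver gt_eqF// -EFinM lee_fin ler_pdivlMr.
Qed.

Let tail (f : nat -> R) n0 : (forall n, (n0 <= n)%N -> 0 <= f n) ->
  exists D, forall n, - D <= \sum_(i0 <= k < n.+1) f k.
Proof.
move=> f0; exists (\sum_(i0 <= k < n0 + i0) `|f k|) => n.
rewrite lerNl -sumrN.
apply: (@le_trans _ _ (\sum_(i0 <= k < n.+1) if (k < n0 + i0)%N then `|f k| else 0)).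
  apply: ler_sum => k _; case: ltnP => [_|n0k]; first by rewrite lerNl lerNnormlW.
  by rewrite oppr_le0 f0//; lia.
have abs0 a b : 0 <= \sum_(a <= k < b) `|f k| by exact: sumr_ge0.
have [nn0|n0n] := leqP n.+1 (n0 + i0).
  have [i0n|ni0] := leqP i0 n.+1; last by rewrite big_geq// ltnW.
  rewrite [leRHS](@big_cat_nat _ _ _ n.+1)//= -[leLHS]addr0 lerD//.
  by apply: ler_sum => k _; case: ifP.
rewrite (@big_cat_nat _ _ _ (n0 + i0))//= ?leq_addl 1?ltnW// [X in _ + X]big_nat.
rewrite [X in _ + X]big1 => [|k /andP[n0k _]]; last by rewrite ltnNge n0k.
by rewrite addr0; apply: ler_sum => k _; case: ifP.
Qed.

Lemma minsol_ratio (L : \bar R) : r @ \oo --> L -> E i0 = L.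
Proof.
move=> rL; apply/eqP; rewrite eq_le; apply/andP; split; rewrite leNgt; apply/negP => LE.
- have [C LC CE] : exists2 C, (L < C%:E)%E & (C%:E < E i0)%E.
    exact: lte_between.
  have [n0 _ rC] : \forall n \near \oo, (r n < C%:E)%E.
    exact: rL (open_ereal_lt' LC).
  have [|D hD] := @tail (fun k => C * u Q i0 k - V k) n0.
    by move=> n n0n; rewrite subr_ge0; apply/ratio_leP/ltW/rC.
  have VH n : Vs n <= C * Hs n + (D - C).
    by have := hD n; rewrite sumrB -mulr_sumr /Hs /Vs; lra.
  have [Ei0|] := ltP (E i0) +oo%E.
  + rewrite (minsol_fin Ei0) lte_fin in CE.
    pose s := (C + e i0) / 2.
    have [n1 hn1] := sum_u_unbounded ((D - C) / (s - C)) Ei0.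
    have : (E i0 <= s%:E)%E.
      apply: ratio_eventually_le; exists n1 => // n /= n1n.
      rewrite ler_pdivrMr//.
      have hn : (D - C) / (s - C) <= Hs n.
        apply: (le_trans (ltW hn1)); rewrite lerD2l.
        have [i0n|/ltnW ni0] := leqP i0 n1.+1.
          rewrite [leRHS](@big_cat_nat _ _ _ n1.+1)//= lerDl sumr_ge0// => k _.
          exact: u_ge0.
        by rewrite big_geq// sumr_ge0// => k _; exact: u_ge0.
      move: hn; rewrite ler_pdivrMr; last by rewrite /s; lra.
      by have := VH n; lra.
    by rewrite (minsol_fin Ei0) lee_fin /s; lra.
  + rewrite leye_eq => /eqP Ei0.
    have : (E i0 <= (C + `|D - C|)%:E)%E.
      apply: minsol_le_ratio => n; rewrite ler_pdivrMr// mulrDl.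
      apply: (le_trans (VH n)); rewrite lerD2l (le_trans (ler_norm _))//.
      by rewrite ler_peMr.
    by rewrite Ei0 leye_eq.
- have [C EC CL] : exists2 C, (E i0 < C%:E)%E & (C%:E < L)%E.
    exact: lte_between.
  have Ei0 : (E i0 < +oo)%E by apply: lt_trans EC (ltry _).
  rewrite (minsol_fin Ei0) lte_fin in EC.
  have [n0 _ rC] : \forall n \near \oo, (C%:E < r n)%E.
    exact: rL (open_ereal_gt' CL).
  have [|D hD] := @tail (fun k => V k - C * u Q i0 k) n0.
    by move=> n n0n; rewrite subr_ge0; apply/ratio_geP/ltW/rC.
  have [n1] := sum_u_unbounded ((D + C) / (C - e i0)) Ei0.
  rewrite ltr_pdivrMr ?subr_gt0//.
  have := hD n1; rewrite sumrB -mulr_sumr -/(Vs n1).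
  have : Vs n1 <= e i0 * Hs n1.
    by rewrite -ler_pdivrMr// -lee_fin -minsol_fin// ltW// ratio_lt_minsol.
  rewrite /Hs; lra.
Qed.

End minimal_solution.

(** * Moments of the return time *)

Lemma measurable_fun_natb d (T : measurableType d) (R : realType) (b : T -> bool) :
  measurable_fun setT b -> measurable_fun setT (fun x => (b x)%:R : R).
Proof.
move=> mb; rewrite (_ : (fun _ => _) = fun x => if b x then 1 else 0); last first.
  by apply/funext => x; case: (b x).
exact: measurable_fun_ifT.
Qed.

Section layer_cake.
Context d (T : measurableType d) (R : realType).
Notation leb := (@lebesgue_measure R).

Let k (a : nat) (s : R) := (0 <= s)%R%:R * (a.+1%:R * s ^+ a).

Let k_ge0 a s : 0 <= k a s.
Proof.
rewrite /k; case: (leP 0 s) => [s0|]; last by rewrite mul0r.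
by rewrite !mulr_ge0 ?exprn_ge0.
Qed.

Let mk a : measurable_fun setT (k a).
Proof.
apply: measurable_funM; first by apply: measurable_fun_natb; exact: measurable_fun_ler.
by apply: measurable_funM => //; exact: measurable_funX.
Qed.

Let integral_k a (y : R) : 0 <= y ->
  (\int[leb]_s (k a s * (s < y)%R%:R)%:E = (y ^+ a.+1)%:E)%E.
Proof.
move=> y0.
transitivity (\int[leb]_(s in `[0%R, y[) (a.+1%:R * s ^+ a)%:E)%E.
  rewrite [RHS]integral_mkcond; apply: eq_integral => s _.
  rewrite patchE mem_setE in_itv/= /k.
  by case: (leP 0 s) => s0; case: ltP => sy /=; rewrite ?mulr1 ?mul1r ?mulr0 ?mul0r.
move: y0; rewrite le_eqVlt => /predU1P[<-|y0].
  by rewrite set_itvco0 integral_set0 expr0n.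
rewrite integral_itv_bndo_bndc; last first.
  apply/measurable_EFinP; apply: measurable_funTS; apply: measurable_funM => //.
rewrite (@continuous_FTC2 _ _ (fun s => s ^+ a.+1))//.
- by rewrite [0 ^+ _]expr0n/= sube0.
- apply: continuous_subspaceT => s; apply: cvgMl_tmp.
  exact: exprn_continuous.
- split=> [s _||]; first exact: exprn_derivable.
  + by apply: cvg_at_right_filter; exact: exprn_continuous.
  + by apply: cvg_at_left_filter; exact: exprn_continuous.
- by move=> s _; rewrite exp_derive1.
Qed.

Lemma layer_cake (mu : {sigma_finite_measure set T -> \bar R}) (W X : T -> R) a :
  measurable_fun setT W -> (forall x, 0 <= W x) ->
  measurable_fun setT X -> (forall x, 0 <= X x) ->
  (\int[mu]_x (W x * X x ^+ a.+1)%:E =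
   \int[leb]_s (((0 <= s)%R%:R * (a.+1%:R * s ^+ a))%:E *
     \int[mu]_x (W x * (s < X x)%R%:R)%:E))%E.
Proof.
move=> mW W0 mX X0.
pose f (z : T * R) := (W z.1 * (k a z.2 * (z.2 < X z.1)%R%:R))%:E.
have mlt : measurable_fun setT (fun z : T * R => (z.2 < X z.1)%R%:R : R).
  apply: measurable_fun_natb; apply: measurable_fun_ltr => //.
  exact: measurableT_comp.
have mf : measurable_fun setT f.
  apply/measurable_EFinP; apply: measurable_funM; first exact: measurableT_comp.
  by apply: measurable_funM => //; exact: measurableT_comp.
have f0 z : (0 <= f z)%E by rewrite lee_fin mulr_ge0// mulr_ge0//.
transitivity (\int[mu]_x \int[leb]_s f (x, s))%E.
  apply: eq_integral => x _; rewrite /f/=.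
  under eq_integral do rewrite EFinM.
  rewrite ge0_integralZl//.
  - by rewrite integral_k// -EFinM.
  - apply/measurable_EFinP; apply: measurable_funM; first exact: mk.
    by apply: measurable_fun_natb; exact: measurable_fun_ltr.
  - by move=> s _; rewrite lee_fin mulr_ge0 ?k_ge0.
  - by rewrite lee_fin.
rewrite fubini_tonelli//; apply: eq_integral => s _.
rewrite -ge0_integralZl//.
- by apply: eq_integral => x _; rewrite /f/= -EFinM mulrCA.
- apply/measurable_EFinP; apply: measurable_funM => //.
  by apply: measurable_fun_natb; exact: measurable_fun_ltr.
- by move=> x _; rewrite lee_fin mulr_ge0.
- by rewrite lee_fin k_ge0.
Qed.

End layer_cake.

Section exponential_moments.
Context (R : realType).
Notation leb := (@lebesgue_measure R).
Variable q : R.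
Hypothesis q_gt0 : 0 < q.

Let expN (t : R) := expR (- (q * t)).

Let continuous_expN : continuous expN.
Proof.
move=> t; apply: continuous_comp; last exact: continuous_expR.
by apply: cvgN; apply: cvgMl_tmp.
Qed.

Let measurable_expN : measurable_fun setT expN.
Proof. exact: continuous_measurable_fun. Qed.

Let integral_expN s : (\int[leb]_(t in `[s, +oo[) (expN t)%:E = (expN s / q)%:E)%E.
Proof.
rewrite (@ge0_continuous_FTC2y _ expN (fun t => - (expN t / q)) s 0).
- by rewrite sub0e -EFinN opprK.
- by move=> t _; exact: expR_ge0.
- exact: continuous_subspaceT.
- rewrite -oppr0; apply: cvgN; rewrite -(mul0r q^-1); apply: cvgMr_tmp.
  rewrite (_ : expN = (fun z => expR (- z)) \o ( *%R q)) //.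
  apply: (@cvg_comp _ _ _ _ _ _ (pinfty_nbhs R)); last exact: cvgr_expR.
  exact: gt0_cvgMry.
- by move=> t _; exact: ex_derive.
- apply: cvg_at_right_filter; apply: cvgN; apply: cvgMr_tmp; exact: continuous_expN.
- move=> t _; rewrite derive1E; apply: derive_val.
  apply: is_derive_eq; rewrite scaler0 add0r /GRing.scale/= mulr1 -/(expN t); field.
  exact: lt0r_neq0.
Qed.

Let weight (t : R) := (0 <= t)%R%:R * expN t.

Let weight_ge0 t : 0 <= weight t. Proof. by rewrite mulr_ge0 ?expR_ge0. Qed.

Let measurable_weight : measurable_fun setT weight.
Proof.
apply: measurable_funM => //; apply: measurable_fun_natb; exact: measurable_fun_ler.
Qed.

Let integral_tail s : 0 <= s ->
  (\int[leb]_t (weight t * (s < `|t|)%R%:R)%:E = (q^-1 * expN s)%:E)%E.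
Proof.
move=> s0; rewrite mulrC -integral_expN -integral_itv_obnd_cbnd; last first.
  by apply/measurable_EFinP; exact: measurable_funTS.
rewrite [RHS]integral_mkcond; apply: eq_integral => t _.
rewrite patchE mem_setE in_itv/= andbT /weight.
case: (leP 0 t) => t0.
  by rewrite ger0_norm// mul1r; case: ltP => _; rewrite ?mulr1 ?mulr0.
by rewrite [s < t]ltNge (ltW (lt_le_trans t0 s0))/= !mul0r.
Qed.

Let moment_of_tail d (T : measurableType d) (mu : {sigma_finite_measure set T -> \bar R})
    (W X : T -> R) (C : R) a :
  measurable_fun setT W -> (forall x, 0 <= W x) ->
  measurable_fun setT X -> (forall x, 0 <= X x) -> 0 <= C ->
  (forall s, 0 <= s -> (\int[mu]_x (W x * (s < X x)%R%:R)%:E = (C * expN s)%:E)%E) ->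
  (\int[mu]_x (W x * X x ^+ a.+1)%:E =
    (C * a.+1%:R)%:E * \int[leb]_t (weight t * `|t| ^+ a)%:E)%E.
Proof.
move=> mW W0 mX X0 C0 tail; rewrite layer_cake// -ge0_integralZl//.
- apply: eq_integral => s _; case: (leP 0 s) => s0 /=; last first.
    by rewrite /weight leNgt s0 !mul0r mul0e mule0.
  rewrite tail// -!EFinM /weight s0 ger0_norm//; congr (_%:E).
  by rewrite !mul1r; ring.
- apply/measurable_EFinP; apply: measurable_funM => //.
  exact: measurable_funX.
- by move=> s _; rewrite lee_fin mulr_ge0 ?exprn_ge0.
- by rewrite lee_fin mulr_ge0.
Qed.

Let gamma a : (\int[leb]_t (weight t * `|t| ^+ a)%:E = (a`!%:R / q ^+ a.+1)%:E)%E.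
Proof.
elim: a => [|a IH].
  transitivity (\int[leb]_(t in `[0%R, +oo[) (expN t)%:E)%E.
    rewrite [RHS]integral_mkcond; apply: eq_integral => t _.
    rewrite patchE mem_setE in_itv/= andbT /weight expr0 mulr1.
    by case: (leP 0 t) => _; rewrite ?mul1r ?mul0r.
  by rewrite integral_expN /expN mulr0 oppr0 expR0 expr1.
rewrite (moment_of_tail _ _ _ _ _ _ integral_tail)//.
- rewrite IH -EFinM; congr (_%:E).
  by rewrite factS natrM [q ^+ a.+2]exprS invfM; ring.
- by rewrite invr_ge0 ltW.
Qed.

Lemma exponential_moment d (T : measurableType d)
    (mu : {sigma_finite_measure set T -> \bar R}) (W X : T -> R) (C : R) a :
  measurable_fun setT W -> (forall x, 0 <= W x) ->
  measurable_fun setT X -> (forall x, 0 < X x) -> 0 <= C ->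
  (forall s, 0 <= s ->
    (\int[mu]_x (W x * (s < X x)%R%:R)%:E = (C * expR (- (q * s)))%:E)%E) ->
  (\int[mu]_x (W x * X x ^+ a)%:E = (C * (a`!%:R / q ^+ a))%:E)%E.
Proof.
move=> mW W0 mX X0 C0 tail; case: a => [|a]; last first.
  rewrite (moment_of_tail _ _ _ _ _ _ tail)//; last by move=> x; exact: ltW.
  by rewrite gamma -EFinM; congr (_%:E); rewrite factS natrM; ring.
rewrite expr0 divr1 mulr1; transitivity (C * expR (- (q * 0)))%:E.
  rewrite -tail//; apply: eq_integral => x _; rewrite X0 //.
by rewrite mulr0 oppr0 expR0 mulr1.
Qed.

End exponential_moments.

Section path_functionals.
Variables (R : realType) (Q : nat -> nat -> R).
Hypothesis hQ : single_birth_Qmatrix Q.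
Context (d : measure_display) (T : measurableType d).
Variables (P : nat -> probability T R) (Y : nat -> T -> nat) (S : nat -> T -> R).
Hypothesis hX : jump_holding_realization Q P Y S.
Variable i0 : nat.

Let q := exit_rate Q.
Let p := jump_prob Q.

Let mS k : measurable_fun setT (S k). Proof. exact: jh_measurable_holding hX k. Qed.
Let mY k : measurable_fun setT (Y k). Proof. exact: jh_measurable_chain hX k. Qed.

Let mYj k j : measurable_fun setT (fun w => (Y k w == j)%:R : R).
Proof. by apply: measurable_fun_natb; exact: measurable_fun_eqn. Qed.

Definition cylinder r m (z : nat -> nat) (t : nat -> R) (w : T) : R :=
  \prod_(0 <= k < m.+1) ((Y (r + k)%N w == z k) && (t k < S (r + k)%N w)%R)%:R.

Lemma measurable_cylinder r m z t : measurable_fun setT (cylinder r m z t).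
Proof.
apply: measurable_prod => k _; apply: measurable_fun_natb.
apply: measurable_and; first exact: measurable_fun_eqn.
exact: measurable_fun_ltr.
Qed.

Lemma cylinder_ge0 r m z t w : 0 <= cylinder r m z t w.
Proof. by apply: prodr_ge0. Qed.

Let scons T' (a : T') (f : nat -> T') k := if k is k'.+1 then f k' else a.

Lemma cylinder_cons r m j s z t w :
  cylinder r m.+1 (scons j z) (scons s t) w =
  ((Y r w == j) && (s < S r w)%R)%:R * cylinder r.+1 m z t w.
Proof.
rewrite /cylinder big_nat_recl//= addn0; congr (_ * _).
by apply: eq_bigr => k _; rewrite addSnnS.
Qed.

(* [W] depends on the past up to time [r] only: conditionally on [Y r = j], the
   future is that of the chain started at [j], and [kappa j] is the integral of
   [W] over the event [Y r = j]. *)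
Record past_weight n r (kappa : nat -> R) (W : T -> R) : Prop := {
  pw_measurable : measurable_fun setT W;
  pw_ge0 : forall w, 0 <= W w;
  pw_kappa_ge0 : forall j, 0 <= kappa j;
  pw_law : forall m z t, (forall k, 0 <= t k) ->
    (\int[P n]_w (W w * cylinder r m z t w)%:E =
     (kappa (z 0%N) * \prod_(0 <= k < m) p (z k) (z k.+1) *
       \prod_(0 <= k < m.+1) expR (- (q (z k) * t k)))%:E)%E
}.

Lemma past_weight_one n : past_weight n 0 (fun j => (j == n)%:R) (fun=> 1).
Proof.
split=> // m z t t0.
pose A := [set w | forall k, (k <= m)%N -> Y k w = z k /\ t k < S k w].
have cE w : cylinder 0 m z t w = \1_A w.
  rewrite indicE; case: (boolP (w \in A)) => [|/negP]; rewrite inE => hA.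
    rewrite /cylinder big_nat big1// => k km.
    by have [|<- ->] := hA k; [lia|rewrite add0n eqxx].
  have /existsNP[k /not_implyP[km /not_andP kA]] := hA.
  rewrite /cylinder (bigD1_seq k) ?iota_uniq ?mem_index_iota//=.
  rewrite add0n; case: eqP => [e|_] /=; last by rewrite mul0r.
  by case: ltP => h; [case: kA => /(_ _)//|rewrite mul0r].
have mA : measurable A.
  have := measurable_cylinder 0 m z t measurableT (measurable_set1 1).
  rewrite setTI; congr measurable; apply/seteqP; split=> w /=; rewrite cE indicE.
    by case: (boolP (w \in A)) => [|_ /eqP]; rewrite ?inE// mulr0n eq_sym oner_eq0.
  by move=> hA; rewrite mem_set.
rewrite -(jh_law hX n m z t0) -/A -(setIT A) -integral_indic//.
by apply: eq_integral => w _; rewrite mul1r cE.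
Qed.

Lemma past_weight_step n r kappa W j a : past_weight n r kappa W ->
  past_weight n r.+1 (fun k => kappa j * p j k * (a`!%:R / q j ^+ a))
    (fun w => W w * (Y r w == j)%:R * S r w ^+ a).
Proof.
move=> [mW W0 k0 law]; have q0 : 0 < q j by exact: exit_rate_gt0.
have S0 k w : 0 <= S k w by exact/ltW/(jh_holding_gt0 hX).
split=> [|w|k|m z t t0].
- by apply: measurable_funM; [exact: measurable_funM|exact: measurable_funX].
- by rewrite !mulr_ge0 ?exprn_ge0.
- by rewrite !mulr_ge0 ?(jump_prob_ge0 hQ)// invr_ge0 exprn_ge0// ltW.
under eq_integral do rewrite mulrAC.
set C := kappa j * \prod_(0 <= k < m.+1) p (scons j z k) (scons j z k.+1) *
  \prod_(0 <= k < m.+1) expR (- (q (z k) * t k)).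
rewrite (exponential_moment q0 (C := C))//.
- congr (_%:E); rewrite /C big_nat_recl//=; ring.
- by apply: measurable_funM; [exact: measurable_funM|exact: measurable_cylinder].
- by move=> w; rewrite !mulr_ge0 ?cylinder_ge0.
- by move=> w; exact: (jh_holding_gt0 hX).
- rewrite !mulr_ge0 ?prodr_ge0// => k _; exact: (jump_prob_ge0 hQ).
move=> s s0; transitivity
    (\int[P n]_w (W w * cylinder r m.+1 (scons j z) (scons s t) w)%:E)%E.
  apply: eq_integral => w _; rewrite cylinder_cons; congr (_%:E).
  case: eqP => _ /=; last by rewrite !(mulr0, mul0r).
  by rewrite mulr1 -[LHS]mulrA [X in _ * X]mulrC.
rewrite law; last by case.
congr (_%:E); rewrite /C [X in _ * X = _]big_nat_recl//=; ring.
Qed.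

Lemma past_weight_mass n r kappa W j : past_weight n r kappa W ->
  (\int[P n]_w (W w * (Y r w == j)%:R)%:E = (kappa j)%:E)%E.
Proof.
move=> [_ _ _ law]; have := law 0%N (fun=> j) (fun=> 0) (fun=> lexx _).
rewrite big_geq// big_nat1 mulr1 mulr0 oppr0 expR0 mulr1 => <-.
apply: eq_integral => w _; rewrite /cylinder big_nat1 addn0.
by rewrite (jh_holding_gt0 hX) andbT.
Qed.

Lemma past_weight_partition n r kappa W N (f : T -> R) (c : nat -> R) :
  past_weight n r kappa W -> (forall k, (N <= k)%N -> kappa k = 0) ->
  measurable_fun setT f -> (forall w, 0 <= f w) ->
  (forall k, (\int[P n]_w (W w * (Y r w == k)%:R * f w)%:E = (kappa k * c k)%:E)%E) ->
  (\int[P n]_w (W w * f w)%:E = (\sum_(0 <= k < N) kappa k * c k)%:E)%E.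
Proof.
move=> [mW W0 _ _] kN mf f0 fk.
have tail (h : nat -> \bar R) N' : (forall k, 0 <= h k)%E ->
    (forall k, (N' <= k)%N -> h k = 0)%E ->
    (\sum_(0 <= k <oo) h k = \sum_(0 <= k < N') h k)%E.
  move=> h0 hN; rewrite (nneseries_split 0 N')//= add0n.
  by rewrite [X in (_ + X)%E]eseries0 ?adde0// => k /hN.
transitivity (\int[P n]_w \sum_(0 <= k <oo) (W w * (Y r w == k)%:R * f w)%:E)%E.
  apply: eq_integral => w _; rewrite (tail _ (Y r w).+1).
  - rewrite big_nat_recr//= big_nat big1 ?add0e ?eqxx ?mulr1// => k /andP[_ kY].
    by rewrite gtn_eqF// mulr0 mul0r.
  - by move=> k; rewrite lee_fin !mulr_ge0.
  - by move=> k kY; rewrite ltn_eqF// mulr0 mul0r.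
rewrite integral_nneseries//.
- under eq_eseriesr do rewrite fk.
  rewrite (tail _ N); first by rewrite sumEFin.
  + move=> k; rewrite -fk; apply: integral_ge0 => w _; rewrite lee_fin !mulr_ge0//.
  + by move=> k /kN->; rewrite mul0r.
- move=> k; apply/measurable_EFinP; apply: measurable_funM => //; exact: measurable_funM.
- by move=> k w _; rewrite lee_fin !mulr_ge0.
Qed.

(* [eta_(min(N,m))], for the chain shifted by [r] steps. *)
Fixpoint truncated_return m r (w : T) : R :=
  if m is m'.+1
  then S r w + (Y r.+1 w != i0)%:R * truncated_return m' r.+1 w else 0.

Fixpoint avoids m r (w : T) : R :=
  if m is m'.+1 then (Y r.+1 w != i0)%:R * avoids m' r.+1 w else 1.

(* [x_m^l(j)], from the binomial expansion of the sum of the first holding time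
   and of the remaining time. *)
Fixpoint return_moment m l j : R :=
  if m is m'.+1 then
    \sum_(b < l.+1) 'C(l, b)%:R * ((l - b)`!%:R / q j ^+ (l - b)) *
      \sum_(0 <= k < j.+2)
        p j k * (if k == i0 then (b == 0%N :> nat)%:R else return_moment m' b k)
  else (l == 0%N)%:R.

Let mYNj k j : measurable_fun setT (fun w => (Y k w != j)%:R : R).
Proof. by apply: measurable_fun_natb; apply: measurable_neg; exact: measurable_fun_eqn. Qed.

Lemma measurable_truncated_return m r : measurable_fun setT (truncated_return m r).
Proof.
elim: m r => //= m IH r; apply: measurable_funD => //; exact: measurable_funM.
Qed.

Lemma truncated_return_ge0 m r w : 0 <= truncated_return m r w.
Proof.
elim: m r => //= m IH r; rewrite addr_ge0 ?mulr_ge0//.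
exact/ltW/(jh_holding_gt0 hX).
Qed.

Lemma measurable_avoids m r : measurable_fun setT (avoids m r).
Proof. by elim: m r => //= m IH r; exact: measurable_funM. Qed.

Lemma avoids_ge0 m r w : 0 <= avoids m r w.
Proof. by elim: m r => //= m IH r; rewrite mulr_ge0. Qed.

Lemma integral_truncated_return m l n r kappa W j : past_weight n r kappa W ->
  (\int[P n]_w (W w * (Y r w == j)%:R * truncated_return m r w ^+ l)%:E =
   (kappa j * return_moment m l j)%:E)%E.
Proof.
elim: m l r kappa W j => [|m IH] l r kappa W j hW /=.
  rewrite expr0n; case: eqP => _ /=.
    by rewrite mulr1 -(past_weight_mass j hW); apply: eq_integral => w _; rewrite mulr1.
  by rewrite mulr0; apply: integral0_eq => w _; rewrite mulr0.
have S0 k w : 0 <= S k w by exact/ltW/(jh_holding_gt0 hX).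
have W0 := pw_ge0 hW; have mW := pw_measurable hW.
pose Wb b w := W w * (Y r w == j)%:R * S r w ^+ (l - b).
pose f b w := ((Y r.+1 w != i0)%:R * truncated_return m r.+1 w) ^+ b.
have f0 b w : 0 <= f b w by rewrite exprn_ge0// mulr_ge0// truncated_return_ge0.
have mf b : measurable_fun setT (f b).
  by apply: measurable_funX; apply: measurable_funM => //; exact: measurable_truncated_return.
have hWb b := past_weight_step j (l - b) hW.
transitivity (\int[P n]_w \sum_(b < l.+1) (('C(l, b))%:R%:E * (Wb b w * f b w)%:E))%E.
  apply: eq_integral => w _; rewrite exprDn mulr_sumr -sumEFin.
  apply: eq_bigr => b _; rewrite -EFinM -mulr_natl /Wb /f; congr (_%:E); ring.
rewrite ge0_integral_sum//; last 2 first.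
- move=> b; apply: emeasurable_funM => //; apply/measurable_EFinP.
  by apply: measurable_funM => //; exact: (pw_measurable (hWb b)).
- by move=> b w _; rewrite mule_ge0 ?lee_fin// mulr_ge0//; exact: (pw_ge0 (hWb b)).
rewrite mulr_sumr -sumEFin; apply: eq_bigr => b _.
rewrite ge0_integralZl//; last 2 first.
- by apply/measurable_EFinP; apply: measurable_funM => //; exact: (pw_measurable (hWb b)).
- by move=> w _; rewrite lee_fin mulr_ge0//; exact: (pw_ge0 (hWb b)).
rewrite (past_weight_partition (N := j.+2) (f := f b)
  (c := fun k => if k == i0 then (b == 0%N :> nat)%:R else return_moment m b k) (hWb b))//.
- rewrite -EFinM; congr (_%:E); rewrite !mulr_sumr; apply: eq_bigr => k _.
  by move: (_ / _) (if _ then _ else _) => A B; ring.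
- by move=> k jk; rewrite /p (jump_prob_far hQ)// mulr0 mul0r.
move=> k; case: eqVneq => ki0.
  rewrite mulrC EFinM -(past_weight_mass k (hWb b)) -ge0_integralZl//.
  - apply: eq_integral => w _; rewrite -EFinM; congr (_%:E); rewrite [RHS]mulrC /f.
    case: (eqVneq (Y r.+1 w) k) => [->|_]; last by rewrite mulr0 !mul0r.
    by rewrite ki0 eqxx /= mul0r expr0n.
  - apply/measurable_EFinP; apply: measurable_funM => //; exact: (pw_measurable (hWb b)).
  - by move=> w _; rewrite lee_fin mulr_ge0//; exact: (pw_ge0 (hWb b)).
rewrite -(IH b _ _ _ k (hWb b)); apply: eq_integral => w _; congr (_%:E).
case: (eqVneq (Y r.+1 w) k) => [e|_]; last by rewrite !(mulr0, mul0r).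
by rewrite /f e ki0 mul1r.
Qed.

Lemma integral_avoids m n r kappa W j : past_weight n r kappa W ->
  (\int[P n]_w (W w * (Y r w == j)%:R * avoids m r w)%:E =
   (kappa j * iter m (killed Q i0) (fun=> 1) j)%:E)%E.
Proof.
elim: m r kappa W j => [|m IH] r kappa W j hW /=.
  by rewrite mulr1 -(past_weight_mass j hW); apply: eq_integral => w _; rewrite mulr1.
have hW' := past_weight_step j 0 hW.
pose f w := (Y r.+1 w != i0)%:R * avoids m r.+1 w.
transitivity (\int[P n]_w (W w * (Y r w == j)%:R * S r w ^+ 0 * f w)%:E)%E.
  by apply: eq_integral => w _; rewrite expr0 mulr1.
rewrite (past_weight_partition (N := j.+2)
  (c := fun k => (k != i0)%:R * iter m (killed Q i0) (fun=> 1) k) hW')//.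
- congr (_%:E); rewrite /killed mulr_sumr [RHS]big_mkcond/=; apply: eq_bigr => k _.
  by rewrite fact0 expr0 divr1 mulr1; case: eqP => _ /=; rewrite ?mul0r ?mulr0// mul1r mulrA.
- by move=> k jk; rewrite /p (jump_prob_far hQ)// mulr0 mul0r.
- by apply: measurable_funM => //; exact: measurable_avoids.
- by move=> w; rewrite mulr_ge0// avoids_ge0.
move=> k; rewrite mulrCA EFinM -(IH _ _ _ k hW') -ge0_integralZl//.
- apply: eq_integral => w _; rewrite -EFinM /f; congr (_%:E).
  by case: (eqVneq (Y r.+1 w) k) => [->|_]; [ring|rewrite !(mulr0, mul0r)].
- apply/measurable_EFinP; apply: measurable_funM; last exact: measurable_avoids.
  by apply: measurable_funM => //; exact: (pw_measurable hW').
- by move=> w _; rewrite lee_fin !mulr_ge0 ?avoids_ge0//; exact: (pw_ge0 hW).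
Qed.

Lemma expectation_truncated_return m l n :
  (\int[P n]_w (truncated_return m 0 w ^+ l)%:E = (return_moment m l n)%:E)%E.
Proof.
have h := past_weight_one n.
transitivity (\int[P n]_w (1 * truncated_return m 0 w ^+ l)%:E)%E.
  by apply: eq_integral => w _; rewrite mul1r.
rewrite (past_weight_partition (N := n.+1) (c := return_moment m l) h).
- rewrite big_nat_recr//= eqxx mul1r big_nat big1 ?add0r// => k kn.
  by rewrite (_ : k == n = false) ?mul0r//; lia.
- by move=> k nk; rewrite gtn_eqF.
- by apply: measurable_funX; exact: measurable_truncated_return.
- by move=> w; rewrite exprn_ge0// truncated_return_ge0.
- by move=> k; exact: (integral_truncated_return m l k h).
Qed.

Lemma expectation_avoids m n :
  (\int[P n]_w (avoids m 0 w)%:E = (iter m (killed Q i0) (fun=> 1) n)%:E)%E.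
Proof.
have h := past_weight_one n.
transitivity (\int[P n]_w (1 * avoids m 0 w)%:E)%E.
  by apply: eq_integral => w _; rewrite mul1r.
rewrite (past_weight_partition (N := n.+1) (c := iter m (killed Q i0) (fun=> 1)) h).
- rewrite big_nat_recr//= eqxx mul1r big_nat big1 ?add0r// => k kn.
  by rewrite (_ : k == n = false) ?mul0r//; lia.
- by move=> k nk; rewrite gtn_eqF.
- exact: measurable_avoids.
- by move=> w; exact: avoids_ge0.
- by move=> k; exact: (integral_avoids m k h).
Qed.

Lemma return_moment0 m j : return_moment m 0 j = 1.
Proof.
elim: m j => //= m IH j.
rewrite big_ord1 bin0 subn0 fact0 expr0 divr1 !mul1r -[RHS](sum_jump_prob hQ j).
by apply: eq_bigr => k _; rewrite IH /=; case: (k == i0); exact: mulr1.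
Qed.

Lemma return_momentS m l j : return_moment m.+1 l.+1 j =
  l.+1%:R * return_moment m.+1 l j / q j + killed Q i0 (return_moment m l.+1) j.
Proof.
have q0 : q j != 0 by rewrite lt0r_neq0// exit_rate_gt0.
rewrite {1}/return_moment -/return_moment big_ord_recr/=; congr (_ + _); last first.
  rewrite binn subnn fact0 expr0 divr1 !mul1r /killed [RHS]big_mkcond/=.
  by apply: eq_bigr => k _; case: eqP; rewrite ?mulr0.
rewrite mulr_sumr mulr_suml; apply: eq_bigr => b _ /=.
have bl : (b <= l)%N by rewrite -ltnS.
have cnt : ('C(l.+1, b) * (l.+1 - b)`! = l.+1 * ('C(l, b) * (l - b)`!))%N.
  apply/eqP; rewrite -(eqn_pmul2r (fact_gt0 b)); apply/eqP.
  have e := bin_fact (leqW bl); rewrite factS -(bin_fact bl) in e.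
  by move: e; rewrite -!mulnA ![(b`! * _)%N]mulnC => <-; rewrite !mulnA.
have cntR := congr1 (fun n => n%:R : R) cnt; rewrite /= !natrM in cntR.
rewrite [X in X * _ = _]mulrA cntR subSn// exprS invfM.
move: (\sum_(0 <= k < _) _) ((q j)^-1) ((q j ^+ (l - b))^-1) => A B C; ring.
Qed.

End path_functionals.

Section return_time_limit.
Variables (R : realType) (Q : nat -> nat -> R).
Hypothesis hQ : single_birth_Qmatrix Q.
Context (d : measure_display) (T : measurableType d).
Variables (P : nat -> probability T R) (Y : nat -> T -> nat) (S : nat -> T -> R).
Hypothesis hX : jump_holding_realization Q P Y S.
Variable i0 : nat.

Let S_gt0 k w : 0 < S k w. Proof. exact: (jh_holding_gt0 hX). Qed.

Local Notation tr := (truncated_return Y S i0).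
Local Notation jt := (jump_time S).

Lemma le_jump_time w m n : (m <= n)%N -> jt m w <= jt n w.
Proof.
move=> mn; rewrite /jump_time [leRHS](@big_cat_nat _ _ _ m)//= lerDl sumr_ge0//.
by move=> k _; exact: ltW.
Qed.

Lemma jump_timeS w m : jt m.+1 w = jt m w + S m w.
Proof. by rewrite /jump_time big_nat_recr. Qed.

Lemma X_at t w k : jt k w <= t < jt k.+1 w -> X Y S t w = Some (Y k w).
Proof.
move=> /andP[kt tk]; apply: xget_unique; first by exists k; rewrite kt tk.
move=> _ [k' [/andP[k't tk'] ->]]; congr (Some (Y _ w)).
have [kk'|k'k|//] := ltngtP k k'.
  by have := le_jump_time w kk'; rewrite leNgt (le_lt_trans k't tk).
by have := le_jump_time w k'k; rewrite leNgt (le_lt_trans kt tk').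
Qed.

Lemma X_visit t w j : X Y S t w = Some j ->
  exists k, jt k w <= t < jt k.+1 w /\ Y k w = j.
Proof.
by rewrite /X; case: xgetP => // _ -> [k [kt ->]] [<-]; exists k.
Qed.

Lemma X_visit_after t w j : jt 1 w <= t -> X Y S t w = Some j ->
  exists k, [/\ (0 < k)%N, jt k w <= t & Y k w = j].
Proof.
move=> t1 /X_visit[k [/andP[kt tk] Yk]]; exists k; split=> //.
by case: k tk {kt Yk} => //; rewrite ltNge t1.
Qed.

Definition first_return w N :=
  [/\ (0 < N)%N, Y N w = i0 & forall k, (0 < k < N)%N -> Y k w != i0].

Lemma first_return_or_never w :
  (exists N, first_return w N) \/ (forall k, (0 < k)%N -> Y k w != i0).
Proof.
have [ex|nex] := pselect (exists k, (0 < k)%N && (Y k w == i0)).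
  left; case: (ex_minnP ex) => N /andP[N0 /eqP YN] minN; exists N; split=> //.
  move=> k /andP[k0 kN]; apply/negP => Yk.
  by have := minN k; rewrite k0 Yk => /(_ isT); rewrite leqNgt kN.
right=> k k0; apply/negP => Yk; apply: nex; exists k; exact/andP.
Qed.

Lemma return_time_first w N : first_return w N -> return_time Y S i0 w = (jt N w)%:E.
Proof.
move=> [N0 YN minN]; apply/eqP; rewrite eq_le; apply/andP; split.
  apply: ereal_inf_lbound; exists (jt N w) => //; split; first exact: le_jump_time.
  by rewrite (X_at (k := N)) ?YN// lexx jump_timeS ltrDl S_gt0.
apply: le_ereal_inf_tmp => _ [t [t1 Xt] <-].
have [k [k0 kt Yk]] := X_visit_after t1 Xt.
rewrite lee_fin (le_trans _ kt)// le_jump_time// leqNgt; apply/negP => kN.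
by have := minN k; rewrite k0 kN Yk eqxx => /(_ isT).
Qed.

Lemma return_time_never w : (forall k, (0 < k)%N -> Y k w != i0) ->
  return_time Y S i0 w = +oo%E.
Proof.
move=> nev; rewrite /return_time (_ : [set _ | _ in _] = set0) ?ereal_inf0//.
apply/seteqP; split=> // x [t [t1 Xt] _].
have [k [k0 _ Yk]] := X_visit_after t1 Xt.
by have := nev _ k0; rewrite Yk eqxx.
Qed.

Lemma return_time_ge0 w : (0 <= return_time Y S i0 w)%E.
Proof.
have [[N hN]|nev] := first_return_or_never w; last by rewrite return_time_never.
rewrite (return_time_first hN) lee_fin sumr_ge0// => k _; exact: ltW.
Qed.

Lemma truncated_return_before w m r : (forall k, (r < k < r + m)%N -> Y k w != i0) ->
  tr m r w = \sum_(r <= k < r + m) S k w.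
Proof.
elim: m r => [|m IH] r nev /=; first by rewrite addn0 big_geq.
rewrite big_ltn ?addnS ?ltnS ?leq_addr//; congr (_ + _).
case: m IH nev => [|m] IH nev; first by rewrite mulr0 big_geq// addn0.
rewrite nev; last by lia.
by rewrite mul1r IH ?addSn// => k ?; apply: nev; lia.
Qed.

Lemma truncated_return_after w m N r : (0 < N <= m)%N -> Y (r + N)%N w = i0 ->
  (forall k, (r < k < r + N)%N -> Y k w != i0) ->
  tr m r w = \sum_(r <= k < r + N) S k w.
Proof.
elim: m N r => [|m IH] [|N] r //= Nm YN nev.
rewrite big_ltn ?addnS ?ltnS ?leq_addr//; congr (_ + _).
case: N Nm YN nev => [|N] Nm YN nev.
  by rewrite addn0 big_geq// -YN addn1 eqxx mul0r.
rewrite nev; last by lia.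
rewrite mul1r (IH N.+1)//.
- by rewrite -YN addSnnS.
- by move=> k ?; apply: nev; lia.
Qed.

Lemma truncated_return_first w N m : first_return w N -> (N <= m)%N ->
  tr m 0 w = jt N w.
Proof. by move=> [N0 YN minN] Nm; apply: truncated_return_after; rewrite ?N0. Qed.

Lemma truncated_return_never w m : (forall k, (0 < k)%N -> Y k w != i0) ->
  tr m 0 w = jt m w.
Proof.
by move=> nev; rewrite truncated_return_before// => k /andP[k0 _]; exact: nev.
Qed.

Lemma truncated_return_nd r w : nondecreasing_seq (fun m => tr m r w).
Proof.
apply/nondecreasing_seqP => m; elim: m r => [|m IH] r.
  by rewrite (truncated_return_ge0 hX).
by rewrite [leLHS]/= [leRHS]/= lerD2l ler_wpM2l.
Qed.

Lemma avoids_never w m r : (forall k, (r < k)%N -> Y k w != i0) ->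
  avoids R Y i0 m r w = 1.
Proof.
elim: m r => //= m IH r nev; rewrite nev// mul1r IH// => k ?; apply: nev; lia.
Qed.

Lemma avoids_after w m r N : (0 < N <= m)%N -> Y (r + N)%N w = i0 ->
  avoids R Y i0 m r w = 0.
Proof.
elim: m N r => [|m IH] [|N] r //= Nm YN.
case: N Nm YN => [|N] Nm YN; first by rewrite -YN addn1 eqxx mul0r.
by rewrite (IH N.+1) ?mulr0// -YN addSnnS.
Qed.

Lemma avoids_le1 m r w : avoids R Y i0 m r w <= 1.
Proof.
elim: m r => //= m IH r; case: eqP => _; rewrite ?mul0r ?mul1r//.
Qed.

Lemma expey l : (0 < l)%N -> ((+oo : \bar R) ^+ l = +oo)%E.
Proof. by case: l => // l _; elim: l => // l IH; rewrite expeS IH mulyy. Qed.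

Lemma truncated_return_cvg w l :
  (return_time Y S i0 w = +oo -> explosion_time S w = +oo)%E ->
  (tr m 0 w ^+ l)%:E @[m --> \oo] --> (return_time Y S i0 w ^+ l)%E.
Proof.
move=> expl; case: l => [|l]; first by rewrite expe0; apply: cvg_near_cst; exact: nearW.
have [[N hN]|nev] := first_return_or_never w.
  rewrite (return_time_first hN) -EFin_expe; apply: cvg_near_cst.
  by exists N => // m /= Nm; rewrite (truncated_return_first hN Nm).
have rty := return_time_never nev; rewrite rty expey//.
apply/cvgeyPge => A; have : ((Num.max 1 A)%:E < explosion_time S w)%E.
  by rewrite expl// ltry.
move=> /ereal_sup_gt[_ [N _ <-]]; rewrite lte_fin gt_max => /andP[N1 NA].
exists N => // m /= Nm; rewrite lee_fin truncated_return_never//.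
have le1 : 1 <= jt m w by rewrite (le_trans (ltW N1))// le_jump_time.
rewrite (le_trans (ltW NA))// (le_trans (le_jump_time w Nm))//.
by rewrite exprS ler_peMr ?exprn_ege1// (le_trans ler01).
Qed.

Lemma measurable_return_time_expe l :
  measurable_fun setT (fun w => return_time Y S i0 w ^+ l)%E.
Proof.
apply: (emeasurable_fun_cvg (fun m w => if avoids R Y i0 m 0 w == 0
   then (tr m 0 w ^+ l)%:E else (+oo ^+ l)%E)).
  move=> m; apply: measurable_fun_ifT => //.
    by apply: measurable_fun_eqr => //; exact: (measurable_avoids hX).
  apply/measurable_EFinP; apply: measurable_funX.
  exact: (measurable_truncated_return hX).
move=> w _; apply: cvg_near_cst; have [[N hN]|nev] := first_return_or_never w.
  exists N => // m /= Nm; have [N0 YN _] := hN.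
  rewrite (avoids_after (N := N)) ?N0// eqxx (truncated_return_first hN Nm).
  by rewrite (return_time_first hN) EFin_expe.
apply: nearW => m; rewrite avoids_never// oner_eq0 return_time_never//.
Qed.

Lemma cvg_moment n l :
  {ae P n, forall w, return_time Y S i0 w = +oo%E -> explosion_time S w = +oo%E} ->
  (return_moment Q i0 m l n)%:E @[m --> \oo] --> moment P Y S i0 l n.
Proof.
move=> ae_expl.
have mtr m : measurable_fun setT (fun w => (tr m 0 w ^+ l)%:E).
  apply/measurable_EFinP; apply: measurable_funX.
  exact: (measurable_truncated_return hX).
have tr0 m w : (0 <= (tr m 0 w ^+ l)%:E)%E.
  by rewrite lee_fin exprn_ge0// (truncated_return_ge0 hX).
have trnd w : {homo (fun m => (tr m 0 w ^+ l)%:E) : m m' / (m <= m')%N >-> (m <= m')%E}.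
  move=> m m' mm'; rewrite lee_fin lerXn2r ?nnegrE ?(truncated_return_ge0 hX)//.
  exact: truncated_return_nd.
under eq_fun do rewrite -(expectation_truncated_return hQ hX).
rewrite (_ : moment P Y S i0 l n =
    \int[P n]_w limn (fun m => (tr m 0 w ^+ l)%:E))%E; last first.
  apply: ge0_ae_eq_integral => //.
  - exact: measurable_return_time_expe.
  - apply: (emeasurable_fun_cvg (fun m w => (tr m 0 w ^+ l)%:E)) => // w _.
    exact: ereal_nondecreasing_is_cvgn.
  - by move=> w _; rewrite expe_ge0// return_time_ge0.
  - move=> w _; apply: lime_ge; first exact: ereal_nondecreasing_is_cvgn.
    exact: nearW.
  - apply: filterS ae_expl => w hw _; apply/esym/cvg_lim => //.
    exact: truncated_return_cvg.
by apply: cvg_monotone_convergence => // w _; exact: trnd.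
Qed.

Lemma moment_lty_ae n l : (0 < l)%N -> (moment P Y S i0 l n < +oo)%E ->
  {ae P n, forall w, return_time Y S i0 w != +oo%E}.
Proof.
move=> l0 fin; have int : (P n).-integrable setT (fun w => return_time Y S i0 w ^+ l)%E.
  apply/integrableP; split; first exact: measurable_return_time_expe.
  under eq_integral do rewrite gee0_abs ?expe_ge0 ?return_time_ge0//.
  exact: fin.
apply: filterS (integrable_ae measurableT int) => w /(_ I).
by apply: contraTneq => ->; rewrite expey.
Qed.

Lemma return_finite_cvg n l : (0 < l)%N -> (moment P Y S i0 l n < +oo)%E ->
  iter m (killed Q i0) (fun=> 1) n @[m --> \oo] --> 0.
Proof.
move=> l0 /(moment_lty_ae l0) fin.
have mav m : measurable_fun setT (fun w => (avoids R Y i0 m 0 w)%:E).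
  by apply/measurable_EFinP; exact: (measurable_avoids hX).
have [|||_ _] := @dominated_convergence _ _ _ (P n) setT measurableT
  (fun m w => (avoids R Y i0 m 0 w)%:E) (cst 0%E) (cst 1%E) mav (measurable_cst _).
- apply: filterS fin => w rt _.
  have [[N hN]|/return_time_never e] := first_return_or_never w; last by rewrite e in rt.
  apply: cvg_near_cst; exists N => // m /= Nm; have [N0 YN _] := hN.
  by rewrite (avoids_after (N := N)) ?N0.
- exact: finite_measure_integrable_cst.
- apply: nearW => w m _; rewrite gee0_abs ?lee_fin ?avoids_le1//.
  exact: (avoids_ge0).
rewrite integral0; under eq_fun do rewrite (expectation_avoids hQ hX).
by move=> /fine_cvg.
Qed.

End return_time_limit.

Section return_moment_order.
Variables (R : realType) (Q : nat -> nat -> R) (i0 : nat).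
Hypothesis hQ : single_birth_Qmatrix Q.

Let q_gt0 := exit_rate_gt0 hQ.

Lemma return_moment_ge0 m l i : 0 <= return_moment Q i0 m l i.
Proof.
elim: m l i => [|m IH] l i; first by rewrite /= ler0n.
elim: l => [|l IHl] in i *; first by rewrite (return_moment0 hQ).
rewrite (return_momentS hQ) addr_ge0//.
  by rewrite divr_ge0 ?mulr_ge0// ltW.
by apply: (killed_ge0 i0 hQ) => k; exact: IH.
Qed.

Lemma return_moment_gt0 m l i : 0 < return_moment Q i0 m.+1 l i.
Proof.
elim: l => [|l IHl]; first by rewrite (return_moment0 hQ).
rewrite (return_momentS hQ) ltr_wpDr ?divr_gt0 ?mulr_gt0 ?ltr0n//.
by apply: (killed_ge0 i0 hQ) => k; exact: return_moment_ge0.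
Qed.

Lemma return_moment_nd l i : nondecreasing_seq (fun m => return_moment Q i0 m l i).
Proof.
apply/nondecreasing_seqP => m; elim: m l i => [|m IH] l i.
  case: l => [|l]; first by rewrite !(return_moment0 hQ).
  by rewrite [leLHS]/= return_moment_ge0.
elim: l i => [|l IHl] i; first by rewrite !(return_moment0 hQ).
rewrite !(return_momentS hQ) lerD//.
  by rewrite ler_pM2r ?invr_gt0// ler_wpM2l.
by apply: (killed_le hQ) => k _ _; exact: IH.
Qed.

End return_moment_order.

Local Open Scope ereal_scope.

Theorem proposition6p1 (R : realType) (Q : nat -> nat -> R)
  (d : measure_display) (T : measurableType d) (P : nat -> probability T R)
  (Y : nat -> T -> nat) (S : nat -> T -> R) (i0 l : nat)
  (hQ : single_birth_Qmatrix Q)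
  (hX : jump_holding_realization Q P Y S)
  (hl : (1 <= l)%N)
  (herg : forall i, moment P Y S i0 l.-1 i < +oo)
  (huniq : l = 1%N -> nonexplosive P S) :
  let E := moment P Y S i0 l in
  let u := u Q i0 in
  let v := v Q (moment P Y S i0 l.-1) in
  [/\ forall n, (n <= i0)%N ->
        E n = l%:R%:E * (\sum_(n <= k < i0) v k)
              + (1 - \sum_(n <= k < i0) u k)%:E * E i0,
      forall n, (i0 < n)%N ->
        E n = - (l%:R%:E * (\sum_(i0 <= k < n) v k))
              + (1 + \sum_(i0 <= k < n) u k)%:E * E i0,
      E i0 = l%:R%:E * limn_esup (fun n =>
        (\sum_(i0 <= k < n.+1) v k) / (1 + \sum_(i0 <= k < n.+1) u k)%:E) &
      (* in [\bar R], v n / 0 = +oo since v n > 0 *)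
      cvgn (fun n => v n / (u n)%:E) ->
        E i0 = l%:R%:E * limn (fun n => v n / (u n)%:E)].
Proof.
move=> E u v.
have L0 : (0 < l%:R :> R)%R by rewrite ltr0n.
have L1 : l%:R != 0%R :> R by rewrite lt0r_neq0.
have lE : l = l.-1.+1 by rewrite prednK.
have moment_ge0 m n : 0 <= moment P Y S i0 m n.
  by apply: integral_ge0 => w _; rewrite expe_ge0// (return_time_ge0 hX).
have ae_expl n : {ae P n, forall w, return_time Y S i0 w = +oo -> explosion_time S w = +oo}.
  have [l1|l1] := posnP l.-1.
    have ex : nonexplosive P S by apply: huniq; rewrite lE l1.
    by apply: filterS (ex n) => w ->.
  by apply: filterS (moment_lty_ae hX l1 (herg n)) => w + e; rewrite e eqxx.
pose M i := fine (moment P Y S i0 l.-1 i).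
have ME i : moment P Y S i0 l.-1 i = (M i)%:E by rewrite fineK// ge0_fin_numE.
pose gm m i := return_moment Q i0 m.+1 l.-1 i.
(* Dividing the moments by [l] removes the factor [l] from the equation. *)
pose x m i := (return_moment Q i0 m l i / l%:R)%R.
pose E' i := (l%:R^-1)%:E * E i.
have gm_cvg i : gm ^~ i @ \oo --> M i.
  have := cvg_moment hQ hX (l := l.-1) (ae_expl i); rewrite ME => /fine_cvg.
  by rewrite -[X in X -> _]cvg_shiftS.
have gm_le m i : (gm m i <= M i)%R.
  rewrite -(cvg_lim _ (gm_cvg i))//; apply: (@nondecreasing_cvgn_le _ (gm ^~ i)).
    by move=> m1 m2 m12; apply: (return_moment_nd i0 hQ).
  by apply/cvg_ex; exists (M i); exact: gm_cvg.
have gm_ge0 m i : (0 <= gm m i)%R by exact: return_moment_ge0.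
have M_gt0 i : (0 < M i)%R.
  by apply: lt_le_trans (gm_le 0%N i); exact: return_moment_gt0.
have x0 i : x 0%N i = 0%R by rewrite /x lE /= mul0r.
have xS m i : x m.+1 i = (gm m i / exit_rate Q i + killed Q i0 (x m) i)%R.
  rewrite /x {1 2}lE (return_momentS hQ) -lE mulrDl; congr (_ + _)%R.
    by rewrite mulrAC [(_ * _ / l%:R)%R]mulrAC divff// mul1r.
  by rewrite /killed mulr_suml; apply: eq_bigr => k _; rewrite mulrA.
have x_nd i : nondecreasing_seq (x ^~ i).
  move=> m m' mm'; rewrite ler_pM2r ?invr_gt0//.
  exact: (return_moment_nd i0 hQ).
have x_cvg i : (x m i)%:E @[m --> \oo] --> E' i.
  under eq_fun do rewrite /x mulrC EFinM.
  by apply: cvgeZl => //; exact: cvg_moment.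
have EE' i : E i = l%:R%:E * E' i.
  by rewrite /E' muleA -EFinM divff// mul1e.
have survival : E' i0 < +oo -> iter m (killed Q i0) (fun=> 1%R) i0 @[m --> \oo] --> (0%R : R).
  move=> Ei0; apply: (return_finite_cvg hQ hX hl).
  by rewrite -/(E i0) EE' lte_mul_pinfty// lee_fin ltW.
have vE k : v k = (birth_solution Q M k)%:E.
  rewrite /v /Defs.v /birth_solution -sumEFin; apply: eq_bigr => j _.
  by rewrite ME -EFinM.
have svE a b : \sum_(a <= k < b) v k = (\sum_(a <= k < b) birth_solution Q M k)%:E.
  by rewrite -sumEFin; apply: eq_bigr => k _; rewrite vE.
split.
- move=> n; rewrite leq_eqVlt => /predU1P[->|ni0].
    by rewrite !big_geq// mule0 add0e subr0 mul1e.
  rewrite (sum_u_before Q ni0) subrr mul0e adde0 svE EE'.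
  by rewrite (minsol_before hQ M_gt0 gm_le gm_cvg x0 xS x_nd x_cvg ni0).
- move=> n i0n; have h1 : (0 < 1 + \sum_(i0 <= k < n) u k)%R.
    by rewrite ltr_pwDl// sumr_ge0// => k _; exact: u_ge0.
  have [fin|] := ltP (E' i0) +oo.
    have := minsol_fin x0 x_nd x_cvg fin.
    rewrite !EE' (minsol_solution hQ M_gt0 gm_ge0 gm_le gm_cvg x0 xS x_nd x_cvg n fin).
    rewrite svE => ->; rewrite -!EFinM -EFinN -EFinD; congr (_%:E).
    rewrite /killed_solution leqNgt i0n/= -/u; ring.
  rewrite leye_eq => /eqP inf; rewrite !EE' inf svE -EFinM -EFinN.
  have [fin|] := ltP (E' n) +oo.
    by have := minsol_after hQ M_gt0 gm_le x0 xS x_nd x_cvg i0n fin; rewrite inf.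
  rewrite leye_eq => /eqP->; rewrite gt0_muley ?lte_fin// gt0_muley ?lte_fin//.
- rewrite EE' (minsol_limn_esup hQ M_gt0 gm_ge0 gm_le gm_cvg x0 xS x_nd x_cvg).
  congr (_ * limn_esup _); apply/funext => n; rewrite svE.
  have h1 : (1 + \sum_(i0 <= k < n.+1) u k != 0)%R.
    by rewrite gt_eqF// ltr_pwDl// sumr_ge0// => k _; exact: u_ge0.
  by rewrite inver (negPf h1) -EFinM.
- move=> /cvg_ex[r vr]; rewrite EE' (cvg_lim _ vr)//; congr (_ * _).
  apply: (minsol_ratio hQ M_gt0 gm_ge0 gm_le gm_cvg x0 xS x_nd x_cvg survival).
  by under eq_fun do rewrite -vE.
Qed.
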